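(* Let $d,r,k\geq1$ and $0\leq s\leq d$ be integers, let $C>0$, let $\varepsilon,\delta\in(0,1)$, and set $\alpha_d=1+\sqrt{d-1}$ and $D_s=\sum_{\ell=0}^s\binom{d}{\ell}$. Let $\mathcal{A}$ be the random subsampled Walsh--Hadamard measurement operator with $m$ measurements. If $$m\ \geq\ \frac{8D_s\alpha_d^2}{3\varepsilon^2}\log\left(\frac{2D_s}{\delta}\right),$$ then, with probability at least $1-\delta$, simultaneously for every $\mathcal{X}\in\mathfrak{M}_{r,s,k}(C)$ and every target rank vector $\mathbf{r}=(r_1,\ldots,r_{d-1})$ satisfying $\operatorname{rank}_{\mathrm{TT}}(\mathcal{X})\leq\mathbf{r}$, the initializer $$\mathcal{X}_{\mathrm{init}}=\operatorname{TT\text{-}SVD}_{\mathbf{r}}\left(\mathcal{P}_{\mathcal{V}_s}\mathcal{A}^*\mathcal{A}(\mathcal{X})\right)$$ satisfies $$\|\mathcal{X}_{\mathrm{init}}-\mathcal{X}\|_F\leq\varepsilon\|\mathcal{X}\|_F.$$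
   Context: Let $N=2^d$. Tensors $\mathcal{X}\in\mathbb{R}^{2\times\cdots\times 2}$ have $d$ modes, each of size 2. Vectorization: $[\operatorname{vec}(\mathcal{X})]_j=\mathcal{X}(i_1,\ldots,i_d)$ with $j=1+\sum_{q=1}^d(i_q-1)2^{q-1}$, $i_q\in\{1,2\}$. The Frobenius inner product is the entrywise inner product, with norm $\|\mathcal{X}\|_F=\|\operatorname{vec}(\mathcal{X})\|_2$. Measurement operator. Let $\mathbf{H}_2=\frac{1}{\sqrt2}\begin{bmatrix}1&1\\1&-1\end{bmatrix}$ and $\mathbf{H}=\mathbf{H}_2^{\otimes d}\in\mathbb{R}^{N\times N}$ (Kronecker power). Draw $\nu_1,\ldots,\nu_m$ independently and uniformly from $\{1,\ldots,N\}$ (with replacement), and let $\mathbf{S}\in\mathbb{R}^{m\times N}$ be the matrix with $[\mathbf{S}\mathbf{z}]_\ell=z_{\nu_\ell}$. Set $\mathbf{A}=\sqrt{N/m}\,\mathbf{S}\mathbf{H}$ and $\mathcal{A}(\mathcal{X})=\mathbf{A}\operatorname{vec}(\mathcal{X})\in\mathbb{R}^m$. $\mathcal{A}^*:\mathbb{R}^m\to\mathbb{R}^{2\times\cdots\times2}$ is the adjoint with respect to the Euclidean and Frobenius inner products. TT rank. For $q=1,\ldots,d-1$, let $\mathbf{X}^{\langle q\rangle}$ be the $2^q\times 2^{d-q}$ matrix unfolding of $\mathcal{X}$ whose row index is $(i_1,\ldots,i_q)$ and column index is $(i_{q+1},\ldots,i_d)$. Then $\operatorname{rank}_{\mathrm{TT}}(\mathcal{X})=(\operatorname{rank}\mathbf{X}^{\langle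 1\rangle},\ldots,\operatorname{rank}\mathbf{X}^{\langle d-1\rangle})$. Rank vectors $\mathbf{r}$ have positive integer entries; $\operatorname{rank}_{\mathrm{TT}}(\mathcal{X})\leq\mathbf{r}$ is componentwise, and $\operatorname{rank}_{\mathrm{TT}}(\mathcal{X})\leq r$ for a scalar $r$ means every component is at most $r$. Low-order model. Write $[d]=\{1,\ldots,d\}$. For $S\subseteq[d]$, let $\mathcal{E}_S$ be the canonical basis tensor whose single nonzero entry, equal to 1, is at the index with $i_j=2$ for $j\in S$ and $i_j=1$ for $j\notin S$. Let $\mathcal{V}_s=\operatorname{span}\{\mathcal{E}_S:S\subseteq[d],|S|\leq s\}$ (of dimension $D_s$) and let $\mathcal{P}_{\mathcal{V}_s}$ be the Frobenius-orthogonal projector onto $\mathcal{V}_s$. Define $$\mathrm{LC}_k(s)=\left\{\sum_{t=1}^k\mathcal{X}_{S_t}\ :\ S_t\subseteq[d],\ |S_t|\leq s,\ \mathcal{X}_{S_t}\in\operatorname{span}\{\mathcal{E}_I:I\subseteq S_t\},\ t=1,\ldots,k\right\},$$ $$\mathfrak{M}_{r,s,k}(C)=\left\{\mathcal{X}\in\mathbb{R}^{2\times\cdots\times2}:\ \operatorname{rank}_{\mathrm{TT}}(\mathcal{X})\leq r,\ \mathcal{X}\in\mathrm{LC}_k(s),\ \|\mathcal{X}\|_F\leq C\right\}.$$ Truncated TT-SVD. For a tensor $\mathcal{Z}\in\mathbb{R}^{n_1\times\cdots\times n_d}$ (here all $n_q=2$) and a rank vector $\mathbf{r}=(r_1,\ldots,r_{d-1})$,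 $\operatorname{TT\text{-}SVD}_{\mathbf{r}}(\mathcal{Z})$ is computed as follows. Set $\rho_0=1$ and let $M_1$ be the unfolding of $\mathcal{Z}$ of size $n_1\times(n_2\cdots n_d)$. For $q=1,\ldots,d-1$: given $M_q$ of size $(\rho_{q-1}n_q)\times(n_{q+1}\cdots n_d)$, with row index $(\alpha_{q-1},i_q)$ and column index $(i_{q+1},\ldots,i_d)$, take a singular value decomposition and keep its $\rho_q$ leading singular triples, where $\rho_q\le r_q$ is $r_q$, or the full number of singular values if smaller, giving $U_q\Sigma_qV_q^{\mathsf T}$; reshape $U_q$ into a core $\mathcal{G}_q\in\mathbb{R}^{\rho_{q-1}\times n_q\times\rho_q}$, and reshape $\Sigma_qV_q^{\mathsf T}$ into the next remainder $M_{q+1}$ of size $(\rho_qn_{q+1})\times(n_{q+2}\cdots n_d)$. Finally reshape the last remainder into $\mathcal{G}_d\in\mathbb{R}^{\rho_{d-1}\times n_d\times1}$. The output is the tensor with entries $\mathcal{G}_1(:,i_1,:)\mathcal{G}_2(:,i_2,:)\cdots\mathcal{G}_d(:,i_d,:)$ (matrix products). For $d=1$ there is no truncation and the output is $\mathcal{Z}$. Any choice of singular value decompositions is allowed. *)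

(* Defs.v *)
From HB Require Import structures.
From mathcomp Require Import all_boot all_order all_algebra.
From mathcomp Require Import all_classical all_reals all_analysis.
From mathcomp Require Import mxtens.

Set Implicit Arguments.
Unset Strict Implicit.
Unset Printing Implicit Defensive.

Import Order.TTheory GRing.Theory Num.Theory.

Local Open Scope classical_set_scope.
Local Open Scope ring_scope.

(* Index values 1, 2 of a mode are represented by 0, 1 : 'I_2, and the modes
   1, ..., d by 0, ..., d - 1 : 'I_d. *)
Notation multi_index d := (d.-tuple 'I_2).

(* The codomain is R^o (convertible to R) so that tensors form a vectType R. *)
Definition tensor (R : realType) (d : nat) := {ffun multi_index d -> R^o}.

Section Tensors.
Context {R : realType} {d : nat}.
Implicit Types X Y Z : tensor R d.

Definition frob_dot X Y : R := \sum_i (X i * Y i : R).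

Definition frob_norm X : R := Num.sqrt (frob_dot X X).

(* The multi-index of position j lists the binary digits of j, least
   significant first; see vecE. *)
Definition digits (j : 'I_(2 ^ d)) : multi_index d :=
  [tuple inord (j %/ 2 ^ q %% 2)%N | q < d].

Definition vec X : 'cV[R]_(2 ^ d) := \col_j X (digits j).

Definition canonical_index (S : {set 'I_d}) : multi_index d :=
  [tuple if j \in S then 1 else 0 | j < d].

Definition canonical_tensor (S : {set 'I_d}) : tensor R d :=
  [ffun i => (i == canonical_index S)%:R].

(* The default value of insubd is not reached when q <= d. *)
Definition unfolding X (q : nat)
    : 'M[R]_(#|{: multi_index q}|, #|{: multi_index (d - q)}|) :=
  \matrix_(a, b)
    X (insubd (nseq_tuple d 0)
         ((enum_val a : multi_index q) ++ (enum_val b : multi_index (d - q)))).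

Definition tt_rank X : (d.-1).-tuple nat :=
  [tuple \rank (unfolding X q.+1) | q < d.-1].

Definition tt_rank_le X (r : (d.-1).-tuple nat) : Prop :=
  forall q : 'I_d.-1, (tnth (tt_rank X) q <= tnth r q)%N.

Definition canonical_span (p : pred {set 'I_d}) : {vspace tensor R d} :=
  <<[seq canonical_tensor J | J <- enum p]>>%VS.

Definition low_order_space (s : nat) : {vspace tensor R d} :=
  canonical_span [pred J : {set 'I_d} | (#|J| <= s)%N].

Definition LC (k s : nat) : set (tensor R d) :=
  [set X | exists (S : 'I_k -> {set 'I_d}) (XS : 'I_k -> tensor R d),
     [/\ forall t, (#|S t| <= s)%N,
         forall t, XS t \in canonical_span [pred J : {set 'I_d} | J \subset S t]
       & X = \sum_t XS t]].

Definition low_order_model (r s k : nat) (C : R) : set (tensor R d) :=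
  [set X | [/\ tt_rank_le X [tuple r | _ < d.-1], LC k s X
             & frob_norm X <= C]].

Definition orthogonal_projection (V : {vspace tensor R d}) Z : tensor R d :=
  xget 0 [set Y | Y \in V /\ forall W, W \in V -> frob_dot (Z - Y) W = 0].

(* For a linear f this is the adjoint; see adjointP. *)
Definition adjoint (m : nat) (f : tensor R d -> 'cV[R]_m) (y : 'cV[R]_m)
    : tensor R d :=
  xget 0 [set Z | forall X, frob_dot X Z = \sum_l f X l 0 * y l 0].

End Tensors.

Section WalshHadamard.
Context {R : realType}.

Definition hadamard2 : 'M[R]_2 :=
  (Num.sqrt 2)^-1 *:
    \matrix_(i, j) (if (i == 1) && (j == 1) then -1 else 1).

Definition hadamard (d : nat) : 'M[R]_(2 ^ d) := ntensmx hadamard2 d.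

Definition sampling_mx (m N : nat) (nu : 'I_m -> 'I_N) : 'M[R]_(m, N) :=
  \matrix_(l, j) (j == nu l)%:R.

Definition measurement_mx (d m : nat) (nu : 'I_m -> 'I_(2 ^ d))
    : 'M[R]_(m, 2 ^ d) :=
  Num.sqrt ((2 ^ d)%:R / m%:R) *: (sampling_mx nu *m hadamard d).

Definition measurement (d m : nat) (nu : 'I_m -> 'I_(2 ^ d)) (X : tensor R d)
    : 'cV[R]_m :=
  measurement_mx nu *m vec X.

End WalshHadamard.

Section TTSVD.
Context {R : realType}.

(* Thin singular value decomposition M = U diag(sigma) V^T: the full number of
   singular values of an m x n matrix is min(m, n), zeros included. *)
Definition is_svd (m n : nat) (M : 'M[R]_(m, n)) (U : 'M[R]_(m, minn m n))
    (sigma : 'rV[R]_(minn m n)) (V : 'M[R]_(n, minn m n)) : Prop :=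
  [/\ U^T *m U = 1%:M, V^T *m V = 1%:M,
      forall i, 0 <= sigma 0 i,
      forall i j : 'I_(minn m n), (i <= j)%N -> sigma 0 j <= sigma 0 i
    & M = U *m diag_mx sigma *m V^T].

(* A remainder with n modes left is a map from the remaining multi-indices to
   column vectors; its coordinates are indexed by the current rank index. *)
Definition remainder_mx (rho n : nat) (B : multi_index n.+1 -> 'cV[R]_rho)
    : 'M[R]_(#|{: 'I_rho * 'I_2}|, #|{: multi_index n}|) :=
  \matrix_(a, b)
    B (cons_tuple (enum_val a).2 (enum_val b)) (enum_val a).1 0.

Section Step.
Variables (rho n p r : nat).

Definition keep : 'I_(minn r p) -> 'I_p := widen_ord (geq_minr r p).

Definition tt_core (U : 'M[R]_(#|{: 'I_rho * 'I_2}|, p)) (i : 'I_2)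
    : 'M[R]_(rho, minn r p) :=
  \matrix_(a, b) U (enum_rank (a, i)) (keep b).

Definition tt_next (sigma : 'rV[R]_p) (V : 'M[R]_(#|{: multi_index n}|, p))
    (t : multi_index n) : 'cV[R]_(minn r p) :=
  \col_b (sigma 0 (keep b) * V (enum_rank t) (keep b)).

End Step.

(* tt_svd_rec rs B Y: the sweep started at the remainder B with n.+1 modes left
   and target ranks rs for the n splits still to be made can produce cores
   G_q, ..., G_d such that
   Y (i_q, ..., i_d) = G_q(:,i_q,:) *m ... *m G_d(:,i_d,:).
   The remainder with a single mode left is itself the last core. *)
Fixpoint tt_svd_rec (n rho : nat) (rs : seq nat)
    : (multi_index n.+1 -> 'cV[R]_rho) -> (multi_index n.+1 -> 'cV[R]_rho) ->
      Prop :=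
  match n return (multi_index n.+1 -> 'cV[R]_rho) ->
                 (multi_index n.+1 -> 'cV[R]_rho) -> Prop with
  | 0 => fun B Y => forall i, Y i = B i
  | n1.+1 => fun B Y =>
      exists U sigma V Y',
        [/\ is_svd (remainder_mx B) U sigma V,
            tt_svd_rec (behead rs) (tt_next (head 0 rs)%N sigma V) Y'
          & forall i, Y i =
              tt_core (head 0 rs)%N U (thead i) *m Y' (behead_tuple i)]
  end.

(* is_TTSVD r Z X: X is an output of the truncated TT-SVD of Z, for some choice
   of the singular value decompositions. The sweep starts with rho_0 = 1. *)
Definition is_TTSVD (d : nat)
    : (d.-1).-tuple nat -> tensor R d -> tensor R d -> Prop :=
  match d return (d.-1).-tuple nat -> tensor R d -> tensor R d -> Prop with
  | 0 => fun _ Z X => X = Z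
  | n.+1 => fun r Z X =>
      exists Y : multi_index n.+1 -> 'cV[R]_1,
        tt_svd_rec r (fun i => const_mx (Z i)) Y /\ forall i, X i = Y i 0 0
  end.

End TTSVD.

Section Sampling.
Context {R : realType} {disp : measure_display} {T : measurableType disp}.

(* nu_0, ..., nu_(m-1) are random variables that are mutually independent and
   uniform on 'I_N (with its discrete sigma-algebra). *)
Definition iid_uniform (P : probability T R) (m N : nat)
    (nu : 'I_m -> T -> 'I_N) : Prop :=
  [/\ forall l (A : set 'I_N), measurable (nu l @^-1` A),
      forall l j, P (nu l @^-1` [set j]) = (N%:R^-1)%:E
    & forall (L : {set 'I_m}) (A : 'I_m -> set 'I_N),
        P (\bigcap_(l in [set` L]) (nu l @^-1` A l)) =
        (\prod_(l in L) P (nu l @^-1` A l))%E].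

End Sampling.

Section Facts.
Context {R : realType}.

Lemma vecE (d : nat) (X : tensor R d) (i : multi_index d) (j : 'I_(2 ^ d)) :
  nat_of_ord j = (\sum_(q < d) tnth i q * 2 ^ q)%N -> vec X j 0 = X i.
Proof.
move=> ji; rewrite mxE; congr (X _); apply: eq_from_tnth => q.
rewrite tnth_mktuple; apply: val_inj => /=.
rewrite inordK ?ltn_mod// ji {j ji}.
have lt2 n (f : nat -> nat) : (forall k, f k < 2)%N ->
    (\sum_(k < n) f k * 2 ^ k < 2 ^ n)%N.
  move=> f2; elim: n => [|n ih]; first by rewrite big_ord0.
  rewrite big_ord_recr /= expnS mul2n -addnn -addSn leq_add//.
  by move: (f2 n); case: (f n) => [|[|]]//; rewrite mul1n.
pose f k : nat := nth (0 : 'I_2) i k.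
have f2 k : (f k < 2)%N by exact: ltn_ord.
rewrite (eq_bigr (fun k : 'I_d => f k * 2 ^ k)%N); last first.
  by move=> k _; rewrite /f (tnth_nth 0).
rewrite (tnth_nth 0) -/(f q).
have -> : (\sum_(k < d) f k * 2 ^ k = \sum_(k < q) f k * 2 ^ k + 2 ^ q *
    (f q + 2 * \sum_(k < d - q.+1) f (q.+1 + k) * 2 ^ k))%N.
  rewrite -!(big_mkord xpredT (fun k => f k * 2 ^ k)%N).
  rewrite (@big_cat_nat _ _ _ q)//= ?(ltnW (ltn_ord q))//; congr addn.
  rewrite big_ltn//= mulnDr [X in (X + _)%N = _]mulnC; congr addn.
  rewrite mulnA -expnSr big_distrr/=.
  rewrite -{1}(add0n q.+1) big_addn big_mkord.
  by apply: eq_bigr => k _; rewrite addnC expnD mulnCA.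
rewrite addnC [(2 ^ q * _)%N]mulnC divnMDl ?expn_gt0// divn_small ?lt2// addn0.
by rewrite addnC mulnC modnMDl modn_small.
Qed.

Lemma frob_dot_canonical (d : nat) (Z : tensor R d) (i : multi_index d) :
  frob_dot [ffun j => (j == i)%:R] Z = Z i.
Proof.
rewrite /frob_dot (bigD1 i)//= ffunE eqxx mul1r big1 ?addr0// => j ji.
by rewrite ffunE (negbTE ji) mul0r.
Qed.

Lemma adjointP (d m : nat) (f : {linear tensor R d -> 'cV[R]_m})
    (y : 'cV[R]_m) (X : tensor R d) :
  frob_dot X (adjoint f y) = \sum_l f X l 0 * y l 0.
Proof.
rewrite /adjoint; case: xgetP => [Z _|nex]; first exact.
pose e i : tensor R d := [ffun j => (j == i)%:R].
exfalso; apply: (nex [ffun i => \sum_l f (e i) l 0 * y l 0]) => {}X /=.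
have {2}-> : X = \sum_i (X i : R) *: e i.
  apply/ffunP => j; rewrite sum_ffunE (bigD1 j)//= !ffunE eqxx.
  rewrite big1 => [|i ij]; first by rewrite addr0 /GRing.scale/= mulr1.
  by rewrite !ffunE eq_sym (negbTE ij) scaler0.
rewrite /frob_dot linear_sum.
transitivity (\sum_i \sum_l (X i : R) * f (e i) l 0 * y l 0).
  apply: eq_bigr => i _; rewrite ffunE mulr_sumr.
  by apply: eq_bigr => l _; rewrite mulrA.
rewrite exchange_big; apply: eq_bigr => l _.
rewrite summxE mulr_suml; apply: eq_bigr => i _.
by rewrite linearZ mxE.
Qed.

Lemma frob_dotC (d : nat) (X Y : tensor R d) : frob_dot X Y = frob_dot Y X.
Proof. by apply: eq_bigr => i _; rewrite mulrC. Qed.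

Lemma frob_dotBl (d : nat) (X Y Z : tensor R d) :
  frob_dot (X - Y) Z = frob_dot X Z - frob_dot Y Z.
Proof.
by rewrite /frob_dot -sumrB; apply: eq_bigr => i _; rewrite !ffunE mulrBl.
Qed.

Lemma frob_dot_suml (d n : nat) (a : 'I_n -> R) (F : 'I_n -> tensor R d)
    (Z : tensor R d) :
  frob_dot (\sum_i a i *: F i) Z = \sum_i a i * frob_dot (F i) Z.
Proof.
rewrite /frob_dot; under [RHS]eq_bigr do rewrite mulr_sumr.
rewrite exchange_big; apply: eq_bigr => i _.
rewrite sum_ffunE mulr_suml; apply: eq_bigr => j _.
by rewrite !ffunE mulrA.
Qed.

Lemma frob_dot_eq0 (d : nat) (X : tensor R d) : frob_dot X X = 0 -> X = 0.
Proof.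
move=> /eqP; rewrite psumr_eq0 => [/allP X0|i _]; last by rewrite -expr2 sqr_ge0.
apply/ffunP => i; rewrite ffunE; apply/eqP.
by have := X0 i (mem_index_enum i); rewrite /= mulf_eq0 orbb.
Qed.

Lemma orthogonal_projectionP (d : nat) (V : {vspace tensor R d})
    (Z : tensor R d) :
  orthogonal_projection V Z \in V /\
  forall W, W \in V -> frob_dot (Z - orthogonal_projection V Z) W = 0.
Proof.
rewrite /orthogonal_projection; case: xgetP => [Y _ //|nex]; exfalso.
pose b i : tensor R d := (vbasis V)`_i.
have bV (i : 'I_(\dim V)) : b i \in V.
  by apply: vbasis_mem; rewrite mem_nth// size_tuple.
pose G : 'M[R]_(\dim V) := \matrix_(i, j) frob_dot (b i) (b j).
have Gunit : G \in unitmx.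
  rewrite -row_free_unit -kermx_eq0; apply/rowV0P => c /sub_kermxP cG.
  have /frob_dot_eq0 cb : frob_dot (\sum_i c 0 i *: b i) (\sum_i c 0 i *: b i) = 0.
    rewrite frob_dot_suml big1// => i _.
    rewrite frob_dotC frob_dot_suml.
    have /rowP/(_ i) := cG; rewrite !mxE => cGi.
    rewrite (_ : \sum_j _ = 0) ?mulr0// -[RHS]cGi.
    by apply: eq_bigr => j _; rewrite mxE.
  have /freeP/(_ _ cb) c0 := basis_free (vbasisP V).
  by apply/rowP => i; rewrite mxE c0.
pose c := (\row_j frob_dot Z (b j)) *m invmx G.
apply: (nex (\sum_i c 0 i *: b i)); split=> [|W WV].
  by apply: rpred_sum => i _; apply: rpredZ.
rewrite (coord_vbasis WV) frob_dotC frob_dot_suml big1// => j _.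
rewrite frob_dotC frob_dotBl frob_dot_suml.
have : (c *m G) 0 j = frob_dot Z (b j) by rewrite mulmxKV// mxE.
rewrite mxE => <-; set s1 := (X in _ * (X - _) = _).
rewrite (_ : \sum_i _ = s1) ?subrr ?mulr0//.
by apply: eq_bigr => i _; rewrite [G _ _]mxE.
Qed.

(* Events that only depend on the sample are measurable. *)
Lemma iid_uniform_measurable (disp : measure_display) (T : measurableType disp)
    (P : probability T R) (m N : nat) (nu : 'I_m -> T -> 'I_N)
    (Q : ('I_m -> 'I_N) -> Prop) :
  iid_uniform P nu -> measurable [set w | Q (fun l => nu l w)].
Proof.
move=> [mnu _ _].
rewrite (_ : [set w | _] = \bigcup_(f in [set f : {ffun 'I_m -> 'I_N} | Q f])
    \bigcap_(l in [set: 'I_m]) (nu l @^-1` [set f l])).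
  apply: fin_bigcup_measurable => [|f _]; first exact: finite_finset.
  by apply: fin_bigcap_measurable => [|l _]; [exact: finite_finset|exact: mnu].
apply/seteqP; split=> [w Qw|w [f Qf fw]] /=.
  exists [ffun l => nu l w] => [|l _] /=; last by rewrite ffunE.
  rewrite (_ : fun_of_fin _ = fun l => nu l w)//.
  by apply/funext => l; rewrite ffunE.
rewrite (_ : (fun _ => _) = f)//; apply/funext => l; exact: fw.
Qed.

End Facts.

(* Main.v *)
From HB Require Import structures.
Require Import Defs.
From mathcomp Require Import all_boot all_order all_algebra.
From mathcomp Require Import all_classical all_reals all_analysis.
From mathcomp Require Import mxtens ring lra zify.

Set Implicit Arguments.
Unset Strict Implicit.
Unset Printing Implicit Defensive.

Import Order.TTheory GRing.Theory Num.Theory.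

Local Open Scope ring_scope.

(* In the coordinates of V_s the operator A^*A compresses to (1/m) sum_l x_l x_l^T,
   where the x_l are independent uniform draws from an isotropic family of
   vectors with entries +-1, so |x_l|^2 = D.  Writing G_l for the partial sums,
   the extreme eigenvalues of G_m are controlled by E tr (1 + t G_m)^p and
   E tr (1 - t G_m)^p with t = y / (D p): a rank-one update multiplies the
   expected trace by a scalar factor, because the moments h_k = x^T A^k x of a
   positive semidefinite A are log-convex, so that h_a h_b <= h_0 h_(a+b).
   Letting p tend to infinity yields the two matrix Chernoff tails with neither
   matrix exponentials nor a spectral theorem; y = 3 eta / 4 gives the exponent
   3 m eta^2 / (8 D).  Taking eta = eps / alpha, polarization turns the
   resulting quadratic form bound into |P A^*A X - X| <= eta |X|, and the
   quasi-optimality of the TT-SVD loses a factor alpha = 1 + sqrt (d - 1). *)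

(** * Positive semidefinite forms and their moments *)

(** The obstacle is that powers of a sum of noncommuting matrices have no binomial expansion.
    Telescoping [M ^+ p - A ^+ p] places the rank-one increment between a power of [A] and a power
    of [M], so that every term of the trace becomes a product of scalar moments at [x]. All of these
    are traded for the single moment [x^T A^p x]: it is linear in [A ^+ p], isotropy averages it to
    [\tr (A ^+ p)], and the recursion over the draws closes. The two tails are not symmetric. In
    [1 + t G] positivity is free and the moments increase; in [1 - t G] positivity has to be
    protected, which is done by taking [p] large compared with [m]. Expectations are written as sums
    over all sample maps, and probability enters only at the end, through the common weight of each
    map. The dimension factor in front of the exponential is the trace of the identity. *)

Section QuadraticForms.
Context {R : realFieldType} {n : nat}.
Implicit Types (A B : 'M[R]_n) (x y z : 'cV[R]_n).

Definition bform A x y : R := (x^T *m A *m y) 0 0.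

Definition psd A : Prop := A^T = A /\ forall z, 0 <= bform A z z.

Lemma bformDm A B x y : bform (A + B) x y = bform A x y + bform B x y.
Proof. by rewrite /bform mulmxDr mulmxDl mxE. Qed.

Lemma bformZm c A x y : bform (c *: A) x y = c * bform A x y.
Proof. by rewrite /bform -scalemxAr -scalemxAl mxE. Qed.

Lemma bformBm A B x y : bform (A - B) x y = bform A x y - bform B x y.
Proof. by rewrite -scaleN1r bformDm bformZm mulN1r. Qed.

Lemma bform_summ (I : finType) (F : I -> 'M[R]_n) x y :
  bform (\sum_i F i) x y = \sum_i bform (F i) x y.
Proof. by rewrite /bform mulmx_sumr mulmx_suml summxE. Qed.

Lemma bformDl A x y z : bform A (x + y) z = bform A x z + bform A y z.
Proof. by rewrite /bform linearD /= !mulmxDl mxE. Qed.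

Lemma bformZl A c x z : bform A (c *: x) z = c * bform A x z.
Proof. by rewrite /bform linearZ /= -!scalemxAl mxE. Qed.

Lemma bformDr A x y z : bform A z (x + y) = bform A z x + bform A z y.
Proof. by rewrite /bform !mulmxDr mxE. Qed.

Lemma bformZr A c x z : bform A z (c *: x) = c * bform A z x.
Proof. by rewrite /bform -!scalemxAr mxE. Qed.

Lemma bform_tr A x y : bform A^T x y = bform A y x.
Proof.
rewrite /bform.
have -> : x^T *m A^T *m y = (y^T *m A *m x)^T by rewrite !trmx_mul trmxK mulmxA.
by rewrite mxE.
Qed.

Lemma bform1E x y : bform 1 x y = \sum_i x i 0 * y i 0.
Proof. by rewrite /bform mulmx1 mxE; apply: eq_bigr => i _; rewrite mxE. Qed.

Lemma bform1C x y : bform 1 x y = bform 1 y x.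
Proof. by rewrite !bform1E; apply: eq_bigr => i _; rewrite mulrC. Qed.

Lemma bform1_ge0 x : 0 <= bform 1 x x.
Proof. by rewrite bform1E sumr_ge0// => i _; rewrite -expr2 sqr_ge0. Qed.

Lemma bform1_gt0 x : x != 0 -> 0 < bform 1 x x.
Proof.
move=> xN0; rewrite lt_def bform1_ge0 andbT; apply: contraNneq xN0.
rewrite bform1E => /eqP; rewrite psumr_eq0 => [/allP x0|i _]; last first.
  by rewrite -expr2 sqr_ge0.
apply/eqP/colP => i; rewrite mxE; apply/eqP.
by have := x0 i (mem_index_enum i); rewrite /= mulf_eq0 orbb.
Qed.

Lemma sqmx_scalerAl c A B : (c *: A) * B = c *: (A * B).
Proof. by rewrite -mulmxE -scalemxAl. Qed.

Lemma sqmx_scalerAr c A B : A * (c *: B) = c *: (A * B).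
Proof. by rewrite -mulmxE -scalemxAr. Qed.

Lemma bform_scalar c x y : bform c%:M x y = c * bform 1 x y.
Proof. by rewrite -scalemx1 bformZm. Qed.

(** A rank-one factor cuts a word of noncommuting matrices into two scalars; this keeps the
    expansions below tractable. *)
Lemma bform_rank1 A B x y u v :
  bform (A * (u *m v^T) * B) x y = bform A x u * bform B v y.
Proof.
rewrite /bform -!mulmxE !mulmxA.
have -> : x^T *m A *m u *m v^T *m B *m y = (x^T *m A *m u) *m (v^T *m B *m y).
  by rewrite !mulmxA.
by rewrite [LHS]mxE big_ord1.
Qed.

Lemma bform_mul A B x y : bform (A *m B) x y = bform A x (B *m y).
Proof. by rewrite /bform !mulmxA. Qed.

Lemma bform_congr A B x y : A^T = A ->
  bform (A *m B *m A) x y = bform B (A *m x) (A *m y).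
Proof. by move=> sA; rewrite /bform trmx_mul sA !mulmxA. Qed.

Lemma mxtrace_bform A x y : \tr (A *m (x *m y^T)) = bform A y x.
Proof. by rewrite mulmxA mxtrace_mulC /bform mulmxA [LHS]big_ord1. Qed.

Lemma bform_delta A i : bform A (delta_mx i 0) (delta_mx i 0) = A i i.
Proof. by rewrite /bform trmx_delta -rowE -colE !mxE. Qed.

Lemma psd1 : psd 1.
Proof. by split=> [|z]; [exact: trmx1|exact: bform1_ge0]. Qed.

Lemma psdD A B : psd A -> psd B -> psd (A + B).
Proof.
move=> [sA A0] [sB B0]; split=> [|z]; first by rewrite linearD /= sA sB.
by rewrite bformDm addr_ge0.
Qed.

Lemma psdZ c A : 0 <= c -> psd A -> psd (c *: A).
Proof.
move=> c0 [sA A0]; split=> [|z]; first by rewrite linearZ /= sA.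
by rewrite bformZm mulr_ge0.
Qed.

Lemma psd_congr A B : A^T = A -> psd B -> psd (A *m B *m A).
Proof.
move=> sA [sB B0]; split=> [|z]; first by rewrite !trmx_mul sA sB mulmxA.
by rewrite bform_congr.
Qed.

Lemma psd_rank1 x : psd (x *m x^T).
Proof.
split=> [|z]; first by rewrite trmx_mul trmxK.
rewrite -[_ *m _]mul1r -[1 * _]mulr1 bform_rank1 -[X in _ * X]bform_tr trmx1.
by rewrite -expr2 sqr_ge0.
Qed.

Lemma trmxX A k : A^T = A -> (A ^+ k)^T = A ^+ k.
Proof.
move=> sA; elim: k => [|k ih]; first by rewrite expr0 trmx1.
by rewrite exprSr trmx_mul ih sA mulmxE -exprS exprSr.
Qed.

Lemma psdX A k : psd A -> psd (A ^+ k).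
Proof.
move=> pA; have [sA _] := pA.
have -> : A ^+ k = A ^+ k./2 *m A ^+ odd k *m A ^+ k./2.
  by rewrite !mulmxE -!exprD -{1}(odd_double_half k) addnAC addnn addnC.
apply: psd_congr; first exact: trmxX.
by case: odd => /=; [rewrite expr1|rewrite expr0; exact: psd1].
Qed.

Lemma cauchy_schwarz_bform A x y : psd A ->
  bform A x y ^+ 2 <= bform A x x * bform A y y.
Proof.
move=> [sA A0].
have sym u v : bform A u v = bform A v u by rewrite -{1}sA bform_tr.
have q a b : 0 <= a ^+ 2 * bform A x x + 2 * a * b * bform A x y
                 + b ^+ 2 * bform A y y.
  have := A0 (a *: x + b *: y).
  by rewrite !(bformDl, bformDr, bformZl, bformZr) (sym y x); congr (_ <= _); ring.
have := A0 y; rewrite le_eqVlt => /predU1P[y0|y0].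
  have [xy0|xyN0] := eqVneq (bform A x y) 0.
    by rewrite xy0 -y0 mulr0 expr0n.
  (* When the form vanishes at [y], the quadratic is affine in the second coefficient; this choice
     gives it the value -1. *)
  have := q 1 (- (bform A x x + 1) / (2 * bform A x y)).
  rewrite -y0 mulr0 addr0 => h; exfalso; move: h.
  have -> : 1 ^+ 2 * bform A x x + 2 * 1 * (- (bform A x x + 1)
      / (2 * bform A x y)) * bform A x y = -1 by field.
  lra.
have := q (bform A y y) (- bform A x y).
have -> : bform A y y ^+ 2 * bform A x x + 2 * bform A y y * (- bform A x y)
    * bform A x y + (- bform A x y) ^+ 2 * bform A y y =
  bform A y y * (bform A x x * bform A y y - bform A x y ^+ 2) by ring.
by rewrite pmulr_rge0// subr_ge0.
Qed.

(** Cauchy-Schwarz for the form [A ^+ k] at the vectors [x] and [A *m x]. *)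
Lemma moment_logconvex A x k : psd A ->
  bform (A ^+ k.+1) x x ^+ 2 <= bform (A ^+ k) x x * bform (A ^+ k.+2) x x.
Proof.
move=> pA; have [sA _] := pA.
have := cauchy_schwarz_bform x (A *m x) (psdX k pA).
rewrite -bform_congr// -bform_mul !mulmxE -exprSr -exprS -exprSr.
exact.
Qed.

(* [W = |z|^2 I - z z^T] satisfies [W^2 = |z|^2 W], so [|z|^2 tr (B W) = tr (W B W)]. *)
Lemma bform_le_mxtrace B z : psd B -> bform B z z <= \tr B * bform 1 z z.
Proof.
move=> [sB B0]; have [->|zN0] := eqVneq z 0.
  by rewrite -[0](scale0r 0) !bformZl !mul0r mulr0.
have := bform1_gt0 zN0; set c := bform 1 z z => c0.
pose W := c%:M - z *m z^T.
have sW : W^T = W by rewrite linearB /= tr_scalar_mx trmx_mul trmxK.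
have WW : W *m W = c *: W.
  rewrite {1}/W mulmxBl mul_scalar_mx (_ : z *m z^T *m W = 0) ?subr0//.
  rewrite /W mulmxBr mul_mx_scalar -mulmxA [z^T *m _]mulmxA.
  have -> : z^T *m z = c%:M.
    by rewrite [LHS]mx11_scalar /c /bform mulmx1.
  by rewrite mul_scalar_mx -scalemxAr subrr.
have : 0 <= \tr (W *m B *m W).
  apply: sumr_ge0 => i _.
  by rewrite -bform_delta bform_congr.
rewrite mxtrace_mulC mulmxA WW -scalemxAl mxtraceZ pmulr_rge0//.
rewrite /W mulmxBl mul_scalar_mx linearB /= mxtraceZ mxtrace_mulC mxtrace_bform.
by rewrite subr_ge0 mulrC.
Qed.

Lemma mxtrace_psd_ge0 B : psd B -> 0 <= \tr B.
Proof. by move=> [_ B0]; apply: sumr_ge0 => i _; rewrite -bform_delta. Qed.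

End QuadraticForms.

(** * Log-convex sequences *)

Section LogConvex.
Context {R : realFieldType}.
Variable h : nat -> R.
Hypotheses (h0 : 0 < h 0) (h1 : 0 < h 1).
Hypothesis h_ge0 : forall k, 0 <= h k.
Hypothesis h_conv : forall k, h k.+1 ^+ 2 <= h k * h k.+2.

Lemma logconvex_gt0 k : 0 < h k.
Proof.
suff: 0 < h k /\ 0 < h k.+1 by case.
elim: k => [//|k [hk hk1]]; split=> //.
rewrite lt_def h_ge0 andbT; apply/negP => /eqP hk2.
by have := h_conv k; rewrite hk2 mulr0 leNgt exprn_gt0.
Qed.

(** Log-convexity means that ratios of consecutive terms increase; the ratios at [a] and at [a + b]
    are compared here, cleared of denominators. *)
Lemma logconvex_ratio a b : h a.+1 * h (a + b) <= h a * h (a + b).+1.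
Proof.
elim: b => [|b ih]; first by rewrite addn0 mulrC.
rewrite addnS -(ler_pM2l (logconvex_gt0 (a + b))).
have /(ler_wpM2l (h_ge0 a)) := h_conv (a + b).
have := ler_wpM2r (h_ge0 (a + b).+1) ih.
set x := h a; set y := h _; set z := h _; set w := h _; set v := h _.
by move=> u1 u2; nra.
Qed.

(** Passing from [a] to [a.+1] multiplies the left side by the ratio at [a] and the right side by
    the ratio at [a + b], which is at least as large. *)
Lemma logconvex_prod a b : h a * h b <= h 0 * h (a + b).
Proof.
elim: a => [//|a ih]; rewrite -(ler_pM2l (logconvex_gt0 a)).
have := ler_wpM2l (h_ge0 a.+1) ih; have := ler_wpM2l (h_ge0 0) (logconvex_ratio a b).
rewrite addSn; set x := h a; set y := h _; set z := h _; set w := h _; set v := h _.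
by move=> u1 u2; nra.
Qed.

Lemma logconvex_step k c : c * h 0 <= h 1 -> c * h k <= h k.+1.
Proof.
move=> hc; rewrite -(ler_pM2l h0); apply: le_trans (logconvex_prod 1 k).
by rewrite mulrCA mulrA ler_wpM2r.
Qed.

Lemma logconvex_pow k c : 0 <= c -> c * h 0 <= h 1 -> c ^+ k * h 0 <= h k.
Proof.
move=> c0 hc; elim: k => [|k ih]; first by rewrite expr0 mul1r.
by rewrite exprS -mulrA; apply: le_trans (logconvex_step k hc); rewrite ler_wpM2l.
Qed.

End LogConvex.

(** * Rank-one updates *)

(** Telescoping that respects the order of the factors: powers of [a] stay on the left, powers of
    [b] on the right. *)
Lemma subrXX_noncomm (V : pzRingType) (a b : V) k :
  b ^+ k - a ^+ k = \sum_(i < k) a ^+ i * (b - a) * b ^+ (k.-1 - i).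
Proof.
elim: k => [|k ih]; first by rewrite big_ord0 !expr0 subrr.
rewrite big_ord_recr /= subnn expr0 mulr1.
rewrite (_ : \sum_(i < k) _ = (b ^+ k - a ^+ k) * b); last first.
  rewrite ih mulr_suml; apply: eq_bigr => i _; rewrite -[RHS]mulrA -exprSr.
  by case: i; case: k {ih} => //= k i ik; rewrite subSn.
by rewrite mulrBl mulrBr -exprSr -exprSr addrA subrK.
Qed.

Section RankOneUpdate.
Context {R : realFieldType} {n : nat}.
Variables (A : 'M[R]_n) (x : 'cV[R]_n) (t : R).
Let M := A + t *: (x *m x^T).
Let h k := bform (A ^+ k) x x.
Let g k := bform (M ^+ k) x x.

Lemma rank1_update_mix b a : bform (A ^+ b * M ^+ a) x x =
  h (b + a) + t * \sum_(i < a) h (b + i) * g (a.-1 - i).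
Proof.
rewrite -[M ^+ a](subrK (A ^+ a)) mulrDr bformDm addrC -exprD.
congr (_ + _); rewrite subrXX_noncomm mulr_sumr bform_summ mulr_sumr.
apply: eq_bigr => i _; rewrite /M [A + _ - A]addrC addKr.
rewrite sqmx_scalerAr sqmx_scalerAl sqmx_scalerAr bformZm; congr (_ * _).
by rewrite !mulrA -exprD bform_rank1.
Qed.

Lemma rank1_update_moment k : g k = h k + t * \sum_(i < k) h i * g (k.-1 - i).
Proof. by rewrite -(rank1_update_mix 0 k) expr0 mul1r. Qed.

(** Telescoping and cyclicity of the trace leave the mixed moments of [A ^+ b] and [M ^+ (p.-1 - b)]
    at [x], each of which is expanded once more. *)
Lemma rank1_update_mxtrace p : A^T = A ->
  \tr (M ^+ p) = \tr (A ^+ p) + t * \sum_(b < p)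
     (h p.-1 + t * \sum_(i < p.-1 - b) h (b + i) * g ((p.-1 - b).-1 - i)).
Proof.
move=> sA; have sM : M^T = M.
  by rewrite linearD linearZ /= sA trmx_mul trmxK.
rewrite -[M ^+ p](subrK (A ^+ p)) linearD /= addrC; congr (_ + _).
rewrite subrXX_noncomm linear_sum /= mulr_sumr.
apply: eq_bigr => b _; rewrite /M [A + _ - A]addrC addKr -/M.
rewrite sqmx_scalerAr sqmx_scalerAl mxtraceZ; congr (_ * _).
rewrite -mulmxE mxtrace_mulC mulmxA mxtrace_bform -bform_mul -bform_tr.
rewrite trmx_mul !trmxX// mulmxE rank1_update_mix subnKC//.
by case: p b => [[]|p b]//=; rewrite -ltnS.
Qed.

End RankOneUpdate.

(* [h k] and [g k] stand for [x^T A^k x] and [x^T M^k x], where [M] is the rank-one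
   update [A + t x x^T] or [A - t x x^T] of [A]. *)
Section MomentBounds.
Context {R : realFieldType}.
Variables (h g : nat -> R) (t : R).
Hypotheses (h_ge0 : forall k, 0 <= h k) (g_ge0 : forall k, 0 <= g k).
Hypothesis h_prod : forall a b, h a * h b <= h 0 * h (a + b).

Section Increase.
Hypothesis t_ge0 : 0 <= t.
Hypothesis gE : forall k, g k = h k + t * \sum_(i < k) h i * g (k.-1 - i).
Hypothesis h_incr : forall k, h k <= h k.+1.

Let u := 1 + t * h 0.

(** Once [g j] is replaced by its bound, [h_prod] merges each product into [h 0] times a moment
    independent of [i]. The powers of [u] then form a geometric sum with [u - 1 = t * h 0], and
    [h_incr] raises the remaining index by one. *)
Let increase_step a b : (forall j, (j < a)%N -> g j <= u ^+ j * h j) ->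
  h (b + a) + t * \sum_(i < a) h (b + i) * g (a.-1 - i) <= u ^+ a * h (b + a).
Proof.
case: a => [_|a hg]; first by rewrite big_ord0 mulr0 addr0 expr0 mul1r.
rewrite -lerBrDl -[X in _ - X]mul1r -mulrBl.
apply: le_trans (_ : (u ^+ a.+1 - 1) * h (b + a) <= _); last first.
  by rewrite addnS ler_wpM2l// subr_ge0 exprn_ege1// /u lerDl mulr_ge0.
rewrite -[X in _ - X](expr1n _ a.+1) subrXX [u - 1]addrC addKr -!mulrA ler_wpM2l//.
rewrite mulrCA mulr_suml; apply: ler_sum => i _.
rewrite expr1n mulr1 /=.
have ia : (i <= a)%N by rewrite -ltnS.
apply: le_trans (_ : h (b + i) * (u ^+ (a - i) * h (a - i)) <= _).
  by rewrite ler_wpM2l// hg// ltnS leq_subr.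
rewrite [leLHS]mulrCA ler_wpM2l ?exprn_ge0 ?addr_ge0 ?mulr_ge0//.
by apply: le_trans (h_prod _ _) _; rewrite -addnA subnKC.
Qed.

Lemma moment_increase a b :
  h (b + a) + t * \sum_(i < a) h (b + i) * g (a.-1 - i) <= u ^+ a * h (b + a).
Proof.
apply: increase_step => j _; elim/ltn_ind: j => j ih.
by rewrite gE; exact: (increase_step 0 ih).
Qed.

(** The outer sum is geometric in [u] again; the factor [h 0] on the left stands for a division on
    the right. *)
Lemma moment_increase_sum p :
  h 0 * (t * \sum_(b < p)
     (h p.-1 + t * \sum_(i < p.-1 - b) h (b + i) * g ((p.-1 - b).-1 - i)))
  <= (u ^+ p - 1) * h p.
Proof.
case: p => [|p]; first by rewrite big_ord0 expr0 subrr mul0r !mulr0.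
apply: le_trans (_ : (u ^+ p.+1 - 1) * h p <= _); last first.
  by rewrite ler_wpM2l// subr_ge0 exprn_ege1// /u lerDl mulr_ge0.
rewrite -[X in _ - X](expr1n _ p.+1) subrXX [u - 1]addrC addKr mulrCA mulrA.
rewrite -!mulrA ler_wpM2l// ler_wpM2l// mulr_suml; apply: ler_sum => b _ /=.
rewrite expr1n mulr1.
have bp : (b <= p)%N by rewrite -ltnS.
by have := moment_increase (p - b) b; rewrite subnKC.
Qed.

End Increase.

Section Decrease.
Hypothesis t_ge0 : 0 <= t.
Hypothesis gE : forall k, g k = h k - t * \sum_(i < k) h i * g (k.-1 - i).

Let g_le k : g k <= h k.
Proof. by rewrite gE gerBl mulr_ge0// sumr_ge0// => i _; rewrite mulr_ge0. Qed.

(** A second-order expansion: since [g k <= h k], each subtracted product is at most [h 0 * h p.-2],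
    and there are [p (p - 1) / 2] pairs of indices [b], [i]. *)
Lemma moment_decrease_sum p : (1 < p)%N ->
  p%:R * h p.-1 - t * h 0 * p%:R ^+ 2 / 2 * h p.-2 <=
  \sum_(b < p)
     (h p.-1 - t * \sum_(i < p.-1 - b) h (b + i) * g ((p.-1 - b).-1 - i)).
Proof.
case: p => [//|[//|p]] _ /=.
rewrite big_split /= sumr_const card_ord mulr_natl lerD2l sumrN lerNl opprK.
rewrite -mulr_sumr -!mulrA ler_wpM2l//.
have le1 (b : 'I_p.+2) : \sum_(i < p.+1 - b) h (b + i) * g ((p.+1 - b).-1 - i)
    <= (p.+1 - b)%:R * (h 0 * h p).
  rewrite -[X in X%:R * _]card_ord mulr_natl -sumr_const; apply: ler_sum => i _.
  apply: le_trans (_ : h (b + i) * h ((p.+1 - b).-1 - i) <= _).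
    by rewrite ler_wpM2l// g_le.
  apply: le_trans (h_prod _ _) _.
  suff -> : (b + i + ((p.+1 - b).-1 - i))%N = p by [].
  by case: i => i /= ib; case: b ib => b /= bp ib; lia.
apply: le_trans (ler_sum _ (fun b _ => le1 b)) _.
rewrite -mulr_suml [X in _ <= X](_ : _ = p.+2%:R ^+ 2 / 2 * (h 0 * h p)); last by field.
rewrite ler_wpM2r ?mulr_ge0// ler_pdivlMr// -natr_sum -natrX -natrM ler_nat.
rewrite (reindex_inj rev_ord_inj) /=.
rewrite (eq_bigr (fun i : 'I_p.+2 => i : nat)); last first.
  by move=> i _; rewrite subSS subKn// -ltnS.
rewrite -(big_mkord xpredT id) /= bin2_sum.
rewrite muln2 bin2; apply: (@leq_trans (p.+2 * p.+1)); last by rewrite expnS leq_mul.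
by rewrite -[leqRHS]odd_double_half leq_addl.
Qed.

End Decrease.
End MomentBounds.

(** * Moments and traces of powers of positive semidefinite matrices *)

Section PositiveMoments.
Context {R : realFieldType} {n : nat}.
Implicit Types (A B : 'M[R]_n) (x z : 'cV[R]_n).

Lemma psd_sum (I : finType) (P : pred I) (F : I -> 'M[R]_n) :
  (forall i, P i -> psd (F i)) -> psd (\sum_(i | P i) F i).
Proof.
move=> F0; apply: (big_ind (@psd R n)) => //; last exact: psdD.
by split=> [|z]; [exact: trmx0|rewrite /bform mulmx0 mul0mx mxE].
Qed.

(** For odd [k] the middle factor [A (1 - A)] is rewritten as [A (1 - A) A + (1 - A) A (1 - A)], so
    that both parities reduce to congruences. *)
Lemma psd_subrX A k : psd A -> psd (1 - A) -> psd (A ^+ k - A ^+ k.+1).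
Proof.
move=> pA pB; have [sA _] := pA; have [sB _] := pB.
have -> : A ^+ k - A ^+ k.+1 =
    A ^+ k./2 *m (if odd k then A *m (1 - A) *m A + (1 - A) *m A *m (1 - A)
                  else 1 - A) *m A ^+ k./2.
  have AB : A * (1 - A) = (1 - A) * A by rewrite mulrBr mulrBl mul1r mulr1.
  rewrite !mulmxE (_ : (if _ then _ else _) = A ^+ odd k - A ^+ (odd k).+1); last first.
    case: odd => /=; last by rewrite expr0 expr1.
    have -> : A ^+ 1 - A ^+ 2 = (1 - A) * A by rewrite mulrBl mul1r.
    rewrite -mulrA [(1 - A) * A * (1 - A)]mulrBr mulr1 [A * (_ * _)]mulrA AB.
    by rewrite addrCA subrr addr0.
  rewrite mulrBr mulrBl -!exprD.
  by congr (_ ^+ _ - _ ^+ _); rewrite -{1}(odd_double_half k) -addnn; lia.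
apply: psd_congr; first exact: trmxX.
by case: ifP => // _; apply: psdD; apply: psd_congr.
Qed.

Lemma moment_gt0 A x c k : psd A -> psd (A - c%:M) -> 0 < c -> x != 0 ->
  0 < bform (A ^+ k) x x.
Proof.
move=> pA [_ Ac] c0 xN0; have x0 := bform1_gt0 xN0.
apply: (@logconvex_gt0 _ (fun k => bform (A ^+ k) x x)).
- by rewrite expr0.
- rewrite expr1; apply: (@lt_le_trans _ _ (c * bform 1 x x)).
    by rewrite mulr_gt0.
  by have := Ac x; rewrite bformBm bform_scalar subr_ge0.
- by move=> j; have [_] := psdX j pA.
- by move=> j; exact: moment_logconvex.
Qed.

Lemma moment_prod A x c a b : psd A -> psd (A - c%:M) -> 0 < c ->
  bform (A ^+ a) x x * bform (A ^+ b) x x <=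
  bform (A ^+ 0) x x * bform (A ^+ (a + b)) x x.
Proof.
move=> pA pAc c0; have [->|xN0] := eqVneq x 0.
  by rewrite -(scale0r 0) !bformZl !mul0r.
have gt0 k : 0 < bform (A ^+ k) x x by exact: moment_gt0 pAc _ _.
apply: (@logconvex_prod _ (fun k => bform (A ^+ k) x x)) => //.
  by move=> j; exact: ltW.
by move=> j; exact: moment_logconvex.
Qed.

Lemma moment_step A x c k : psd A -> psd (A - c%:M) -> 0 < c ->
  c * bform (A ^+ k) x x <= bform (A ^+ k.+1) x x.
Proof.
move=> pA pAc c0; have [->|xN0] := eqVneq x 0.
  by rewrite -(scale0r 0) !bformZl !mul0r mulr0.
have gt0 j : 0 < bform (A ^+ j) x x by exact: moment_gt0 pAc _ _.
apply: (@logconvex_step _ (fun k => bform (A ^+ k) x x)) => //.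
- by move=> j; exact: ltW.
- by move=> j; exact: moment_logconvex.
by rewrite expr0 expr1; have [_ /(_ x)] := pAc; rewrite bformBm bform_scalar subr_ge0.
Qed.

Lemma moment_pow A x a k : psd A -> 0 < a -> a * bform 1 x x <= bform A x x ->
  a ^+ k * bform 1 x x <= bform (A ^+ k) x x.
Proof.
move=> pA a0 ha; have [->|xN0] := eqVneq x 0.
  by rewrite -(scale0r 0) !bformZl !mul0r mulr0.
have x0 := bform1_gt0 xN0.
apply: (@logconvex_pow _ (fun k => bform (A ^+ k) x x)); rewrite ?expr0 ?expr1//.
- by apply: lt_le_trans ha; exact: mulr_gt0.
- by move=> j; have [_] := psdX j pA.
- by move=> j; exact: moment_logconvex.
exact: ltW.
Qed.

(** This reads an extreme eigenvalue off the trace: by log-convexity a Rayleigh quotient of at least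
    [a] becomes one of at least [a ^+ k] for [A ^+ k], and the trace dominates every Rayleigh
    quotient. *)
Lemma mxtraceX_ge A x a k : psd A -> 0 < a -> x != 0 ->
  a * bform 1 x x <= bform A x x -> a ^+ k <= \tr (A ^+ k).
Proof.
move=> pA a0 xN0 /(moment_pow k pA a0) ha.
rewrite -(ler_pM2r (bform1_gt0 xN0)); apply: le_trans ha _.
exact/bform_le_mxtrace/psdX.
Qed.

Lemma psd_sub_rank1 x : psd ((bform 1 x x)%:M - x *m x^T).
Proof.
split=> [|z].
  by rewrite linearB /= tr_scalar_mx trmx_mul trmxK.
rewrite bformBm bform_scalar subr_ge0 -[x *m _]mul1r -[1 * _]mulr1 bform_rank1.
rewrite -[X in X * _]bform_tr trmx1 -expr2; exact/cauchy_schwarz_bform/psd1.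
Qed.

End PositiveMoments.

(** * Rank-one updates averaged over an isotropic family *)

Section IsotropicFamily.
Context {R : realFieldType} {n N : nat}.
Variable x : 'I_N -> 'cV[R]_n.
Hypothesis n_gt0 : (0 < n)%N.
Hypothesis x_norm : forall j, bform 1 (x j) (x j) = n%:R.
Hypothesis x_iso : \sum_j x j *m (x j)^T = N%:R%:M.

Lemma sum_bform_isotropic A : \sum_j bform A (x j) (x j) = N%:R * \tr A.
Proof.
under eq_bigr do rewrite -mxtrace_bform.
by rewrite -linear_sum -mulmx_sumr x_iso /= mul_mx_scalar mxtraceZ.
Qed.

Let n0 : 0 < n%:R :> R. Proof. by rewrite ltr0n. Qed.

(** That [A] dominates the identity makes its moments nondecreasing, as the pointwise bound
    requires; summation over [j] then turns the moment of order [p] into a trace. *)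
Lemma mxtrace_increase A t p : psd A -> psd (A - 1) -> 0 <= t ->
  \sum_j \tr ((A + t *: (x j *m (x j)^T)) ^+ p) <=
  N%:R * (1 + ((1 + t * n%:R) ^+ p - 1) / n%:R) * \tr (A ^+ p).
Proof.
move=> pA pA1 t0; have [sA _] := pA.
have pA1' : psd (A - 1%:M) by [].
have le1 j : \tr ((A + t *: (x j *m (x j)^T)) ^+ p) <=
    \tr (A ^+ p) + ((1 + t * n%:R) ^+ p - 1) / n%:R * bform (A ^+ p) (x j) (x j).
  rewrite rank1_update_mxtrace// lerD2l mulrAC ler_pdivlMr// mulrC.
  have := @moment_increase_sum _ (fun k => bform (A ^+ k) (x j) (x j))
    (fun k => bform ((A + t *: (x j *m (x j)^T)) ^+ k) (x j) (x j)) t.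
  rewrite expr0 x_norm; apply=> //.
  - by move=> k; have [_] := psdX k pA.
  - move=> k; have [//|_] := @psdX _ _ (A + t *: (x j *m (x j)^T)) k.
    by apply: psdD => //; apply: psdZ => //; exact: psd_rank1.
  - by move=> a b; rewrite -(x_norm j) -(expr0 A); apply: moment_prod pA1' _ => //.
  - by move=> k; exact: rank1_update_moment.
  - by move=> k; have := moment_step (x j) k pA pA1' ltr01; rewrite mul1r.
apply: le_trans (ler_sum _ (fun j _ => le1 j)) _.
rewrite big_split /= sumr_const card_ord -mulr_sumr sum_bform_isotropic.
by rewrite -mulr_natl le_eqVlt; apply/orP; left; apply/eqP; ring.
Qed.

(** Both lower moments are traded for the one of order [p]: [A <= 1] gives [h p <= h p.-1] for the
    first-order term, and [A >= c] gives [h p.-2 <= h p / c ^+ 2] for the second-order term. *)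
Lemma mxtrace_decrease A (t c : R) p : psd A -> psd (1 - A) -> psd (A - c%:M) -> 0 < c ->
  0 <= t -> (forall j, psd (A - t *: (x j *m (x j)^T))) -> (1 < p)%N ->
  \sum_j \tr ((A - t *: (x j *m (x j)^T)) ^+ p) <=
  N%:R * (1 - t * p%:R + t ^+ 2 * n%:R * p%:R ^+ 2 / 2 / c ^+ 2) * \tr (A ^+ p).
Proof.
move=> pA p1A pAc c0 t0 pM p1; have [sA _] := pA.
have le1 j : \tr ((A - t *: (x j *m (x j)^T)) ^+ p) <=
    \tr (A ^+ p) + (- (t * p%:R) + t ^+ 2 * n%:R * p%:R ^+ 2 / 2 / c ^+ 2)
       * bform (A ^+ p) (x j) (x j).
  pose h k := bform (A ^+ k) (x j) (x j).
  pose g k := bform ((A - t *: (x j *m (x j)^T)) ^+ k) (x j) (x j).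
  have h_ge0 k : 0 <= h k by have [_] := psdX k pA; apply.
  have g_ge0 k : 0 <= g k by have [_] := psdX k (pM j); apply.
  have h0E : h 0 = n%:R by rewrite /h expr0.
  have := @moment_decrease_sum _ h g t h_ge0 g_ge0.
  move=> /(_ (fun a b => moment_prod _ _ _ pA pAc c0) t0) => H.
  have {H} := H _ p p1.
  have gE k : g k = h k - t * \sum_(i < k) h i * g (k.-1 - i)%N.
    by rewrite /g -scaleNr rank1_update_moment mulNr.
  move=> /(_ gE); rewrite h0E => H.
  rewrite -scaleNr rank1_update_mxtrace// lerD2l scaleNr.
  rewrite (eq_bigr (fun b : 'I_p => h p.-1 - t *
    \sum_(i < p.-1 - b) h (b + i)%N * g ((p.-1 - b).-1 - i)%N)); last first.
    by move=> b _; rewrite mulNr.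
  have h1 : h p <= h p.-1.
    have [_ /(_ (x j))] := psd_subrX p.-1 pA p1A.
    by rewrite bformBm subr_ge0 prednK// ltnW.
  have h2 : h p.-2 <= h p / c ^+ 2.
    rewrite ler_pdivlMr ?exprn_gt0// mulrC expr2 -mulrA.
    have := moment_step (x j) p.-2 pA pAc c0.
    have := moment_step (x j) p.-1 pA pAc c0.
    have -> : p.-2.+1 = p.-1 by lia.
    rewrite prednK ?(ltnW p1)// => u1 u2; apply: le_trans u1.
    by rewrite ler_pM2l.
  rewrite mulNr lerNl; apply: le_trans (ler_wpM2l t0 H).
  rewrite -/(h p) mulrBr mulrDl opprD !mulNr opprK lerB//.
    by rewrite -mulrA ler_wpM2l// ler_wpM2l.
  set q := p%:R; have q0 : 0 <= q by rewrite /q ler0n.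
  have -> : t * (t * n%:R * q ^+ 2 / 2 * h p.-2) =
      t ^+ 2 * n%:R * q ^+ 2 / 2 * h p.-2 by ring.
  rewrite -[leRHS]mulrA ler_wpM2l ?mulr_ge0 ?exprn_ge0 ?invr_ge0//.
  by rewrite mulrC.
apply: le_trans (ler_sum _ (fun j _ => le1 j)) _.
rewrite big_split /= sumr_const card_ord -mulr_sumr sum_bform_isotropic.
by rewrite -mulr_natl le_eqVlt; apply/orP; left; apply/eqP; ring.
Qed.

End IsotropicFamily.

(** * Tails of random Gram matrices *)

Section Resampling.
Context {R : realFieldType} {m N : nat}.
Implicit Type f : {ffun 'I_m -> 'I_N}.

Definition resample f (l : 'I_m) (j : 'I_N) : {ffun 'I_m -> 'I_N} :=
  [ffun i => if i == l then j else f i].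

(* Swapping [j] with [f l] is an involution of the pairs [(f, j)]. *)
Lemma sum_resample (G : {ffun 'I_m -> 'I_N} -> R) l :
  \sum_f \sum_j G (resample f l j) = N%:R * \sum_f G f.
Proof.
pose swap (p : {ffun 'I_m -> 'I_N} * 'I_N) := (resample p.1 l p.2, p.1 l).
have swapK : involutive swap.
  move=> [f j]; rewrite /swap /=; congr (_, _); last by rewrite ffunE eqxx.
  by apply/ffunP => i; rewrite !ffunE; case: eqP => [->|].
rewrite pair_big /= (reindex swap) /=; last exact/onW_bij/inv_bij.
rewrite (eq_bigr (fun p : {ffun 'I_m -> 'I_N} * 'I_N => G p.1)); last first.
  by move=> p _; rewrite -[in RHS](swapK p).
rewrite -(pair_big xpredT xpredT (fun f (j : 'I_N) => G f)) /= mulr_sumr.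
by apply: eq_bigr => f _; rewrite sumr_const card_ord mulr_natl.
Qed.

(** Counting form of conditioning on the other draws: averaging over a fresh value at [l] does not
    change the sum over all maps, so the one-step factors multiply. *)
Lemma sum_resample_le (F : nat -> {ffun 'I_m -> 'I_N} -> R) (c : R) :
  (0 < N)%N -> 0 <= c ->
  (forall (l : 'I_m) f, \sum_j F l.+1 (resample f l j) <= N%:R * c * F l f) ->
  \sum_f F m f <= c ^+ m * \sum_f F 0 f.
Proof.
move=> N0 c0 hF; suff H l : (l <= m)%N -> \sum_f F l f <= c ^+ l * \sum_f F 0 f.
  exact: H.
elim: l => [|l ih] lm; first by rewrite expr0 mul1r.
have N0' : 0 < N%:R :> R by rewrite ltr0n.
rewrite -(ler_pM2l N0') -(sum_resample _ (Ordinal lm)).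
apply: le_trans (ler_sum _ (fun f _ => hF (Ordinal lm) f)) _ => /=.
rewrite -mulr_sumr -mulrA ler_pM2l// exprS -mulrA ler_wpM2l//; exact/ih/ltnW.
Qed.

End Resampling.

Section TailBounds.
Context {R : realFieldType} {n N m : nat}.
Variable x : 'I_N -> 'cV[R]_n.
Hypotheses (n_gt0 : (0 < n)%N) (N_gt0 : (0 < N)%N).
Hypothesis x_norm : forall j, bform 1 (x j) (x j) = n%:R.
Hypothesis x_iso : \sum_j x j *m (x j)^T = N%:R%:M.
Implicit Type f : {ffun 'I_m -> 'I_N}.

Definition gram l f : 'M[R]_n :=
  \sum_(i < m | (i < l)%N) x (f i) *m (x (f i))^T.

Lemma gram_resample (l : 'I_m) f j :
  gram l.+1 (resample f l j) = gram l f + x j *m (x j)^T.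
Proof.
rewrite /gram (bigD1 l)//= ffunE eqxx addrC; congr (_ + _).
apply: eq_big => [i|i]; first by rewrite ltnS andbC ltn_neqAle.
by rewrite ffunE => /andP[_ /negbTE ->].
Qed.

Lemma gram0 f : gram 0 f = 0.
Proof. by rewrite /gram big_pred0. Qed.

Lemma psd_gram l f : psd (gram l f).
Proof. by apply: psd_sum => i _; exact: psd_rank1. Qed.

(** Each [x x^T] is at most [n%:R%:M] by Cauchy-Schwarz; this bounds [1 - t G] from below throughout
    the recursion for the lower tail. *)
Lemma psd_scalar_sub_gram l f : psd ((m%:R * n%:R)%:M - gram l f).
Proof.
have -> : (m%:R * n%:R)%:M - gram l f = \sum_(i < m)
    (n%:R%:M - if (i < l)%N then x (f i) *m (x (f i))^T else 0).
  rewrite sumrB -big_mkcond /=; congr (_ - _).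
  by rewrite sumr_const card_ord mulr_natl raddfMn.
apply: psd_sum => i _; case: ifP => _.
  by rewrite -(x_norm (f i)); exact: psd_sub_rank1.
by rewrite subr0 -scalemx1; apply: psdZ => //; exact: psd1.
Qed.

Lemma sum_mxtrace1X k :
  \sum_(f : {ffun 'I_m -> 'I_N}) \tr (1 ^+ k : 'M[R]_n) = N%:R ^+ m * n%:R.
Proof.
rewrite expr1n mxtrace1 sumr_const card_ffun !card_ord.
by rewrite -[n%:R *+ _]mulr_natl natrX.
Qed.

(** Markov's inequality by counting: each bad map contributes at least [(1 + t * a) ^+ p] to the sum
    of the final traces, and the recursion starts with the trace [n] for each of the [N ^ m]
    maps. *)
Lemma upper_tail_count (bad : pred {ffun 'I_m -> 'I_N}) (t a : R) p :
  0 <= t -> 0 <= a ->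
  (forall f, bad f -> exists2 z : 'cV[R]_n,
     z != 0 & a * bform 1 z z <= bform (gram m f) z z) ->
  #|bad|%:R * (1 + t * a) ^+ p <=
  (1 + ((1 + t * n%:R) ^+ p - 1) / n%:R) ^+ m * (N%:R ^+ m * n%:R).
Proof.
move=> t0 a0 hbad.
pose F l f := \tr ((1 + t *: gram l f) ^+ p).
have pG l f : psd (t *: gram l f) by apply: psdZ => //; exact: psd_gram.
have pA l f : psd (1 + t *: gram l f) by apply: psdD => //; exact: psd1.
have F0 f : 0 <= F m f by apply: mxtrace_psd_ge0; exact: psdX.
apply: (@le_trans _ _ (\sum_f F m f)).
  rewrite mulr_natl -sumr_const [leRHS](bigID bad) /= -[leLHS]addr0.
  apply: lerD; last by apply: sumr_ge0.
  apply: ler_sum => f /hbad [z zN0 hz].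
  apply: (mxtraceX_ge _ _ _ zN0) => //; first by rewrite ltr_wpDr ?mulr_ge0.
  by rewrite bformDm bformZm mulrDl mul1r -mulrA lerD2l ler_wpM2l.
rewrite -(sum_mxtrace1X p).
rewrite [X in _ * X](_ : _ = \sum_f F 0%N f); last first.
  by apply: eq_bigr => f _; rewrite /F gram0 scaler0 addr0.
apply: sum_resample_le => //.
  rewrite addr_ge0// divr_ge0// subr_ge0 exprn_ege1//.
  by rewrite lerDl mulr_ge0.
move=> l f; rewrite /F.
have -> : \sum_j \tr ((1 + t *: gram l.+1 (resample f l j)) ^+ p) =
    \sum_j \tr ((1 + t *: gram l f + t *: (x j *m (x j)^T)) ^+ p).
  by apply: eq_bigr => j _; rewrite gram_resample scalerDr addrA.
apply: mxtrace_increase => //.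
by rewrite addrC addKr.
Qed.

(** Here [c] bounds all the matrices [1 - t G] from below, and [K] is any nonnegative bound on the
    one-step factor, so that an exponential can be substituted for it. *)
Lemma lower_tail_count (bad : pred {ffun 'I_m -> 'I_N}) (t a c K : R) p :
  0 <= t -> a <= m%:R * n%:R -> 0 < c -> c = 1 - t * (m%:R * n%:R) -> (1 < p)%N ->
  0 <= K -> 1 - t * p%:R + t ^+ 2 * n%:R * p%:R ^+ 2 / 2 / c ^+ 2 <= K ->
  (forall f, bad f -> exists2 z : 'cV[R]_n,
     z != 0 & bform (gram m f) z z <= a * bform 1 z z) ->
  #|bad|%:R * (1 - t * a) ^+ p <= K ^+ m * (N%:R ^+ m * n%:R).
Proof.
move=> t0 amn c0 cE p1 K0 leK hbad.
pose F l f := \tr ((1 - t *: gram l f) ^+ p).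
have pAc l f : psd (1 - t *: gram l f - c%:M).
  have -> : 1 - t *: gram l f - c%:M = t *: ((m%:R * n%:R)%:M - gram l f).
    by rewrite cE scalerBr scale_scalar_mx raddfB /= opprB addrC addrA subrK.
  by apply: psdZ => //; exact: psd_scalar_sub_gram.
have pA l f : psd (1 - t *: gram l f).
  rewrite -[1 - _](subrK c%:M); apply: psdD => //.
  by rewrite -scalemx1; apply: psdZ; [exact: ltW|exact: psd1].
have F0 f : 0 <= F m f by apply: mxtrace_psd_ge0; exact: psdX.
apply: (@le_trans _ _ (\sum_f F m f)).
  rewrite mulr_natl -sumr_const [leRHS](bigID bad) /= -[leLHS]addr0.
  apply: lerD; last by apply: sumr_ge0.
  apply: ler_sum => f /hbad [z zN0 hz].
  apply: (mxtraceX_ge _ _ _ zN0) => //.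
    by apply: lt_le_trans c0 _; rewrite cE lerB// ler_wpM2l.
  by rewrite bformBm bformZm mulrBl mul1r -mulrA lerB// ler_wpM2l.
rewrite -(sum_mxtrace1X p).
rewrite [X in _ * X](_ : _ = \sum_f F 0%N f); last first.
  by apply: eq_bigr => f _; rewrite /F gram0 scaler0 subr0.
apply: sum_resample_le => // l f; rewrite /F.
have E j : 1 - t *: gram l.+1 (resample f l j) =
    1 - t *: gram l f - t *: (x j *m (x j)^T).
  by rewrite gram_resample scalerDr opprD addrA.
under eq_bigr do rewrite E.
apply: (le_trans (mxtrace_decrease n_gt0 x_norm x_iso (pA l f) _ (pAc l f) c0 t0 _ p1)).
- by rewrite opprB addrC subrK; apply: psdZ => //; exact: psd_gram.
- by move=> j; rewrite -E.
rewrite ler_wpM2r ?ler_wpM2l//; exact/mxtrace_psd_ge0/psdX.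
Qed.

End TailBounds.

(** * Bounds on the exponential and the limit of large powers *)

Section Exponential.
Context {R : realType}.
Implicit Types (u y : R).

(** From the quadratic term on, consecutive Taylor terms have ratio at most [y / 3 <= 1 / 4], so a
    geometric series dominates them; [2 / 3] is [1 / 2] times [1 / (1 - 1 / 4)]. *)
Lemma series_exp_coeff_le y k : 0 <= y <= 3 / 4 ->
  series (exp_coeff y) k.+2 <= 1 + y + 2 / 3 * y ^+ 2 * (1 - 4^-1 ^+ k).
Proof.
move=> /andP[y0 y1]; rewrite /series /=.
have le1 j : y ^+ j.+2 / (j.+2)`!%:R <= y ^+ 2 / 2 * 4^-1 ^+ j.
  elim: j => [|j ih]; first by rewrite expr0 mulr1.
  rewrite exprS factS natrM invfM mulrACA.
  rewrite [4^-1 ^+ _]exprS [leRHS]mulrCA.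
  apply: ler_pM => //; try by rewrite divr_ge0// ?exprn_ge0.
  by rewrite ler_pdivrMr//; apply: le_trans y1 _; rewrite mulrC ler_wpM2l// ler_nat.
elim: k => [|k ih].
  rewrite !big_nat_recl//= big_geq// /exp_coeff /= expr0 expr1 !fact0.
  by rewrite expr0 subrr !mulr0 !addr0 !divr1.
rewrite big_nat_recr//=; apply: le_trans (lerD ih (le1 k)) _.
rewrite [4^-1 ^+ k.+1]exprS; set v := _ ^+ k; lra.
Qed.

Lemma expR_le_quadratic y : 0 <= y <= 3 / 4 -> expR y <= 1 + y + 2 / 3 * y ^+ 2.
Proof.
move=> hy; rewrite /expR; apply: limr_le; first exact: is_cvg_series_exp_coeff.
exists 2%N => // k /=; case: k => [//|[//|k]] _.
apply: le_trans (series_exp_coeff_le k hy) _.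
by have /andP[y0 _] := hy; rewrite lerD2l ler_piMr ?mulr_ge0 ?divr_ge0//.
Qed.

Lemma expR_le_1Dx u : 0 < 1 + u -> expR (u / (1 + u)) <= 1 + u.
Proof.
move=> u0; rewrite -[leRHS]invrK -[leLHS]invrK -expRN.
rewrite lef_pV2 ?posrE ?invr_gt0 ?expR_gt0//.
apply: le_trans (expR_ge1Dx _); rewrite le_eqVlt; apply/orP; left; apply/eqP.
by field; apply: lt0r_neq0.
Qed.

(** The limit in [p], by contradiction. If the conclusion fails, the logarithms have a gap [L > 0],
    whereas [(1 + b / p) ^ p] is at least [exp (b - b ^ 2 / (p + b))], whose loss falls below [L]
    for large [p]. *)
Lemma le_mul_exp_of_pow (P K b : R) (p0 : nat) : 0 <= P -> 0 < K ->
  (forall p, (p0 < p)%N -> 0 < 1 + b / p%:R -> P * (1 + b / p%:R) ^+ p <= K) ->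
  P <= K * expR (- b).
Proof.
move=> P0 K0 hP; rewrite leNgt; apply/negP => ltP.
have Q0 : 0 < P by apply: le_lt_trans ltP; rewrite mulr_ge0 ?expR_ge0// ltW.
have L1 : 1 < P * expR b / K.
  by rewrite ltr_pdivlMr// mul1r -ltr_pdivrMr ?expR_gt0// -expRN.
pose L := ln (P * expR b / K).
have L0 : 0 < L by rewrite ln_gt0.
(* Exceeding [|b| + b ^ 2 / L] ensures both [p + b > 0] and [b ^ 2 / (p + b) < L]. *)
pose p := (p0 + Num.Def.truncn (`|b| + b ^+ 2 / L)).+1.
have pb : `|b| + b ^+ 2 / L < p%:R.
  apply: (@lt_le_trans _ _ (Num.Def.truncn (`|b| + b ^+ 2 / L)).+1%:R).
    apply: truncnS_gt.
  by rewrite ler_nat ltnS leq_addl.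
have b2L : 0 <= b ^+ 2 / L by rewrite divr_ge0 ?sqr_ge0// ltW.
have pDb : b ^+ 2 / L < p%:R + b.
  by have := ler_norm (- b); rewrite normrN; lra.
have pDb0 : 0 < p%:R + b by lra.
have pp : 0 < p%:R :> R by rewrite ltr0n.
have u0 : 0 < 1 + b / p%:R.
  have -> : 1 + b / p%:R = (p%:R + b) / p%:R by field; exact: lt0r_neq0.
  by rewrite divr_gt0.
have := hP p; rewrite u0 ltnS leq_addr => /(_ isT isT); rewrite leNgt => /negP; apply.
apply: (@lt_le_trans _ _ (P * expR (b - b ^+ 2 / (p%:R + b)))).
  have -> : K = P * expR b * expR (- L).
    rewrite expRN lnK ?posrE ?(lt_trans ltr01)//.
    by field; rewrite !lt0r_neq0 ?expR_gt0.
  rewrite expRD mulrA ltr_pM2l ?mulr_gt0 ?expR_gt0// ltr_expR ltrN2.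
  by rewrite ltr_pdivrMr// mulrC -ltr_pdivrMr.
rewrite ler_pM2l//.
have -> : b - b ^+ 2 / (p%:R + b) = p%:R * (b / p%:R / (1 + b / p%:R)).
  by field; rewrite !lt0r_neq0.
by rewrite expRM_natl lerXn2r ?nnegrE ?expR_ge0 ?expR_le_1Dx// ltW.
Qed.

End Exponential.

(** * Exponential tails of the Gram matrix *)

Section ExponentialTails.
Context {R : realType} {n N m : nat}.
Variable x : 'I_N -> 'cV[R]_n.
Hypotheses (n_gt0 : (0 < n)%N) (N_gt0 : (0 < N)%N).
Hypothesis x_norm : forall j, bform 1 (x j) (x j) = n%:R.
Hypothesis x_iso : \sum_j x j *m (x j)^T = N%:R%:M.
Variable eta : R.
Hypothesis eta01 : 0 < eta < 1.

Let n0 : 0 < n%:R :> R. Proof. by rewrite ltr0n. Qed.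
(** The maximizer of [eta * y - 2 / 3 * y ^+ 2], with value [3 / 8 * eta ^+ 2]; [eta < 1] keeps it
    in the range of [expR_le_quadratic]. *)
Let y := 3 / 4 * eta.
Let y01 : 0 < y <= 3 / 4.
Proof. by have /andP[e0 e1] := eta01; apply/andP; split; rewrite /y; lra. Qed.

(** With [t = y / (n p)], one draw costs a factor of at most [1 + (exp y - 1) / n] because
    [(1 + y / p) ^ p <= exp y]. This bound is uniform in [p], so only the gain of the bad maps goes
    to the limit. *)
Lemma upper_tail (bad : pred {ffun 'I_m -> 'I_N}) :
  (forall f, bad f -> exists2 z : 'cV[R]_n,
     z != 0 & (1 + eta) * m%:R * bform 1 z z <= bform (gram x m f) z z) ->
  #|bad|%:R <= N%:R ^+ m * n%:R * expR (- (3 / 8 * eta ^+ 2 * m%:R / n%:R)).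
Proof.
move=> hbad; set a := (1 + eta) * m%:R.
have /andP[e0 e1] := eta01; have /andP[y0 y1] := y01.
have a0 : 0 <= a by rewrite mulr_ge0 ?addr_ge0// ltW.
have := @le_mul_exp_of_pow R #|bad|%:R
  (N%:R ^+ m * n%:R * expR (m%:R / n%:R * (y + 2 / 3 * y ^+ 2))) (y / n%:R * a) 0.
have -> : N%:R ^+ m * n%:R * expR (- (3 / 8 * eta ^+ 2 * m%:R / n%:R)) =
  N%:R ^+ m * n%:R * expR (m%:R / n%:R * (y + 2 / 3 * y ^+ 2)) *
    expR (- (y / n%:R * a)).
  rewrite -[RHS]mulrA -expRD; congr (_ * expR _); rewrite /a /y; field.
  exact: lt0r_neq0.
apply => //; first by rewrite !mulr_gt0 ?expR_gt0 ?exprn_gt0// ltr0n.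
move=> p p0 _; have p0' : 0 < p%:R :> R by rewrite ltr0n.
have := @upper_tail_count R n N m x n_gt0 N_gt0 x_norm x_iso bad (y / n%:R / p%:R) a p.
have -> : y / n%:R / p%:R * a = y / n%:R * a / p%:R by rewrite mulrAC.
have t0 : 0 <= y / n%:R / p%:R by rewrite !divr_ge0// ltW.
move=> /(_ t0 a0 hbad) H; apply: le_trans H _.
rewrite mulrC ler_wpM2l ?mulr_ge0 ?exprn_ge0//.
rewrite -[m%:R / n%:R * _]mulrA expRM_natl.
rewrite lerXn2r ?nnegrE ?expR_ge0//.
  rewrite addr_ge0// divr_ge0// subr_ge0 exprn_ege1//.
  by rewrite lerDl mulr_ge0.
apply: le_trans (expR_ge1Dx _); rewrite lerD2l mulrC ler_pM2l ?invr_gt0//.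
apply: (@le_trans _ _ (expR y - 1)); last first.
  by have := @expR_le_quadratic _ y; rewrite (ltW y0) y1 => /(_ isT); lra.
rewrite lerD2r -[in leRHS](_ : p%:R * (y / n%:R / p%:R * n%:R) = y).
  rewrite expRM_natl lerXn2r ?nnegrE ?expR_ge0 ?expR_ge1Dx//.
  by rewrite addr_ge0// mulr_ge0.
by field; rewrite !lt0r_neq0.
Qed.

(** Taking [p > 8 m] keeps [c] above [7 / 8], hence [1 / (2 c ^ 2)] below [2 / 3]: the quadratic
    term gets the same constant as in the upper tail. *)
Lemma lower_tail (bad : pred {ffun 'I_m -> 'I_N}) :
  (forall f, bad f -> exists2 z : 'cV[R]_n,
     z != 0 & bform (gram x m f) z z <= (1 - eta) * m%:R * bform 1 z z) ->
  #|bad|%:R <= N%:R ^+ m * n%:R * expR (- (3 / 8 * eta ^+ 2 * m%:R / n%:R)).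
Proof.
move=> hbad; set a := (1 - eta) * m%:R.
have /andP[e0 e1] := eta01; have /andP[y0 y1] := y01.
have amn : a <= m%:R * n%:R.
  apply: (@le_trans _ _ (1 * m%:R)); first by rewrite ler_wpM2r//; lra.
  by rewrite mul1r -natrM ler_nat leq_pmulr.
have := @le_mul_exp_of_pow R #|bad|%:R
  (N%:R ^+ m * n%:R * expR (m%:R / n%:R * (- y + 2 / 3 * y ^+ 2)))
  (- (y / n%:R * a)) (8 * m).+1.
have -> : N%:R ^+ m * n%:R * expR (- (3 / 8 * eta ^+ 2 * m%:R / n%:R)) =
  N%:R ^+ m * n%:R * expR (m%:R / n%:R * (- y + 2 / 3 * y ^+ 2)) *
    expR (- - (y / n%:R * a)).
  rewrite -[RHS]mulrA -expRD; congr (_ * expR _); rewrite /a /y; field.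
  exact: lt0r_neq0.
apply => //; first by rewrite !mulr_gt0 ?expR_gt0 ?exprn_gt0// ltr0n.
move=> p pm _; have p0 : 0 < p%:R :> R by rewrite ltr0n; lia.
set t := y / n%:R / p%:R; pose c := 1 - t * (m%:R * n%:R).
have t0 : 0 <= t by rewrite !divr_ge0// ltW.
have c78 : 7 / 8 <= c.
  have -> : c = 1 - y * m%:R / p%:R by rewrite /c /t; field; rewrite !lt0r_neq0.
  suff : y * m%:R / p%:R <= 1 / 8 by lra.
  rewrite ler_pdivrMr//.
  have mp : 8 * m%:R <= p%:R :> R by rewrite -natrM ler_nat; lia.
  have m0 := ler0n R m.
  have ym : y * m%:R <= 1 * m%:R by rewrite ler_wpM2r//; lra.
  by lra.
have c0 : 0 < c by lra.
have tp : t * p%:R = y / n%:R by rewrite /t; field; rewrite !lt0r_neq0.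
have := @lower_tail_count R n N m x n_gt0 N_gt0 x_norm x_iso bad t a c
  (expR (n%:R^-1 * (- y + 2 / 3 * y ^+ 2))) p t0 amn c0 erefl.
have -> : 1 - t * a = 1 + - (y / n%:R * a) / p%:R.
  by rewrite /t; field; rewrite !lt0r_neq0.
move=> /(_ _ (expR_ge0 _) _ hbad) H; apply: le_trans (H _ _) _; first by lia.
  apply: le_trans (expR_ge1Dx _); rewrite -addrA lerD2l mulrDr lerD//.
    by rewrite tp mulrN mulrC.
  rewrite ler_pdivrMr ?exprn_gt0//.
  rewrite [leLHS](_ : _ = n%:R^-1 * (y ^+ 2 / 2)); last first.
    rewrite [_ * n%:R * _]mulrAC -exprMn tp; field; exact: lt0r_neq0.
  rewrite -[leRHS]mulrA ler_pM2l ?invr_gt0//.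
  have c2 : 3 / 4 <= c ^+ 2 by nra.
  have := ler_wpM2l (sqr_ge0 y) c2; lra.
by rewrite [leRHS]mulrC -expRM_natl [m%:R * (_ * _)]mulrA.
Qed.

End ExponentialTails.

(** * Quasi-optimality of the TT-SVD *)

Section FrobeniusSquare.
Context {R : realFieldType}.

Definition mxsq m n (A : 'M[R]_(m, n)) : R := \sum_i \sum_j A i j ^+ 2.

Lemma mxsqE m n (A : 'M[R]_(m, n)) : mxsq A = \tr (A^T *m A).
Proof.
rewrite /mxsq exchange_big; apply: eq_bigr => j _; rewrite mxE.
by apply: eq_bigr => i _; rewrite mxE.
Qed.

Lemma mxsq_ge0 m n (A : 'M[R]_(m, n)) : 0 <= mxsq A.
Proof. by apply: sumr_ge0 => i _; apply: sumr_ge0 => j _; exact: sqr_ge0. Qed.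

Lemma mxsq_orthoD m n (A B : 'M[R]_(m, n)) :
  A^T *m B = 0 -> mxsq (A + B) = mxsq A + mxsq B.
Proof.
move=> AB; have BA : B^T *m A = 0 by rewrite -[A]trmxK -trmx_mul AB trmx0.
rewrite !mxsqE -linearD /=; congr (\tr _).
by rewrite [(A + B)^T]linearD /= mulmxDl !mulmxDr AB BA addr0 add0r.
Qed.

Lemma mxsq_isometry m n p (U : 'M[R]_(m, p)) (A : 'M[R]_(p, n)) :
  U^T *m U = 1%:M -> mxsq (U *m A) = mxsq A.
Proof.
by move=> UU; rewrite !mxsqE trmx_mul -mulmxA [U^T *m _]mulmxA UU mul1mx.
Qed.

Lemma mxsq_pythagoras m n p (U : 'M[R]_(m, p)) (A : 'M[R]_(m, n)) (B : 'M[R]_(p, n)) :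
  U^T *m U = 1%:M ->
  mxsq (A - U *m B) = mxsq (A - U *m (U^T *m A)) + mxsq (U^T *m A - B).
Proof.
move=> UU; rewrite -(mxsq_isometry (U^T *m A - B) UU) -mxsq_orthoD.
  by rewrite mulmxBr addrA subrK.
have UA : (A - U *m (U^T *m A))^T *m U = 0.
  rewrite [(A - _)^T]linearB /= !trmx_mul trmxK mulmxBl -!mulmxA UU mulmx1.
  exact: subrr.
by rewrite mulmxA UA mul0mx.
Qed.

Lemma mxsq_coisometry_le m n p (U : 'M[R]_(m, p)) (A : 'M[R]_(m, n)) :
  U^T *m U = 1%:M -> mxsq (U^T *m A) <= mxsq A.
Proof.
move=> UU; have := mxsq_pythagoras A 0 UU; rewrite mulmx0 !subr0 => ->.
by rewrite lerDr mxsq_ge0.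
Qed.

Lemma mxsq_proj m n (Q : 'M[R]_m) (A : 'M[R]_(m, n)) : Q^T = Q -> Q *m Q = Q ->
  mxsq A = mxsq (Q *m A) + mxsq (A - Q *m A).
Proof.
move=> sQ QQ; rewrite -mxsq_orthoD; first by rewrite addrC subrK.
by rewrite trmx_mul sQ -mulmxA mulmxBr mulmxA QQ subrr mulmx0.
Qed.

Lemma mxsq_projE m n (Q : 'M[R]_m) (A : 'M[R]_(m, n)) : Q^T = Q -> Q *m Q = Q ->
  mxsq (Q *m A) = \tr (A^T *m Q *m A).
Proof.
by move=> sQ QQ; rewrite mxsqE trmx_mul sQ -!mulmxA [Q *m (Q *m A)]mulmxA QQ.
Qed.

(** The projector is [F (F^T F)^-1 F^T] for a factor [F] of [W] of full column rank. Being symmetric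
    and idempotent, it has squared norm equal to its trace, which is the rank. *)
Lemma column_projector m n (W : 'M[R]_(m, n)) :
  exists Q : 'M[R]_m,
    [/\ Q^T = Q, Q *m Q = Q, Q *m W = W & mxsq Q = (\rank W)%:R].
Proof.
have := mulmx_base W.
have : row_free (col_base W)^T by rewrite /row_free mxrank_tr; exact: col_base_full.
move: (col_base W) (row_base W) => F F' Ff WE; pose G := F^T *m F.
have sG : G^T = G by rewrite trmx_mul trmxK.
have Gu : G \in unitmx.
  rewrite -row_free_unit -kermx_eq0; apply/rowV0P => c /sub_kermxP cG.
  have c0 : bform 1 (F *m c^T) (F *m c^T) = 0.
    by rewrite /bform trmx_mul trmxK mulmx1 mulmxA -[c *m _ *m _]mulmxA cG mul0mx mxE.
  have /eqP Fc : F *m c^T == 0.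
    by apply: contraTT isT => /bform1_gt0; rewrite c0 ltxx.
  have : c *m F^T == 0 by rewrite -[c]trmxK -trmx_mul Fc trmx0.
  by rewrite (mulmx_free_eq0 _ Ff) => /eqP.
have sGi : (invmx G)^T = invmx G by rewrite trmx_inv sG.
exists (F *m invmx G *m F^T).
have QF : F *m invmx G *m F^T *m F = F.
  by rewrite -mulmxA -/G mulmxKV.
split.
- by rewrite !trmx_mul trmxK sGi mulmxA.
- by rewrite mulmxA mulmxA QF.
- by rewrite -[X in _ *m X = _]WE mulmxA QF WE.
rewrite mxsqE.
have -> : (F *m invmx G *m F^T)^T = F *m invmx G *m F^T.
  by rewrite !trmx_mul trmxK sGi mulmxA.
by rewrite mulmxA mulmxA QF mxtrace_mulC mulmxA -/G mulmxV// mxtrace1.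
Qed.

(** Weights in [[0, 1]] of total at most [r] do best on the [r] largest values; subtracting the
    threshold [tau], the value at index [r], makes the comparison termwise. *)
Lemma sum_weight_le p r (s w : 'I_p -> R) :
  (forall i, 0 <= s i) -> (forall i j : 'I_p, (i <= j)%N -> s j <= s i) ->
  (forall i, 0 <= w i <= 1) -> \sum_i w i <= r%:R ->
  \sum_i s i * w i <= \sum_(i < p | (i < r)%N) s i.
Proof.
move=> s0 sd w01 wr; have [pr|rp] := leqP p r.
  rewrite [leRHS](eq_bigl xpredT) => [|i]; last by rewrite (leq_trans (ltn_ord i) pr).
  by apply: ler_sum => i _; rewrite ler_piMr//; have /andP[] := w01 i.
set tau := s (Ordinal rp).
rewrite [leRHS]big_mkcond /= -subr_le0 -sumrB.
apply: (@le_trans _ _ (\sum_i (tau * (w i - (i < r)%N%:R)))).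
  apply: ler_sum => i _; have /andP[w0 w1] := w01 i; case: ifP => ir /=.
    have := sd i (Ordinal rp) (ltnW ir); rewrite -/tau => h; nra.
  have := sd (Ordinal rp) i; rewrite leqNgt /= ir -/tau => /(_ isT) h; nra.
rewrite -mulr_sumr sumrB; apply: mulr_ge0_le0 => //; first exact: s0.
rewrite subr_le0 -natr_sum; apply: le_trans wr _; rewrite ler_nat.
rewrite (eq_bigr (fun i : 'I_p => if (i < r)%N then 1 else 0)%N); last first.
  by move=> i _; case: ifP.
by rewrite -big_mkcond -(big_ord_widen _ (fun=> 1%N) (ltnW rp)) sum1_card card_ord.
Qed.

End FrobeniusSquare.

(** * The Eckart-Young inequality *)

Section EckartYoung.
Context {R : realType}.
Variables (m n r : nat) (M : 'M[R]_(m, n)) (U : 'M[R]_(m, minn m n)).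
Variables (sigma : 'rV[R]_(minn m n)) (V : 'M[R]_(n, minn m n)).
Hypothesis svd : is_svd M U sigma V.

Definition lead_vectors : 'M[R]_(m, minn r (minn m n)) := colsub (@keep _ r) U.

Lemma lead_vectors_ortho : lead_vectors^T *m lead_vectors = 1%:M.
Proof.
have [UU _ _ _ _] := svd; apply/matrixP => i j; rewrite mxE.
have UUij : (U^T *m U) (keep i) (keep j) = 1%:M (keep i) (keep j) by rewrite UU.
rewrite [X in X = _]mxE in UUij.
rewrite (eq_bigr (fun k => U^T (keep i) k * U k (keep j))); last first.
  by move=> k _; rewrite !mxE.
by rewrite UUij !mxE.
Qed.

(** The right side is the next remainder of the sweep, so a step of the sweep acts on the remainder
    as multiplication by [lead_vectors^T]. *)
Lemma lead_vectors_mul : lead_vectors^T *m M =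
  \matrix_(b, t) (sigma 0 (keep b) * V t (keep b)).
Proof.
have [UU _ _ _ ->] := svd; rewrite /lead_vectors !mulmxA.
have -> : (colsub (@keep _ r) U)^T *m U = rowsub (@keep _ r) 1%:M.
  by rewrite -UU; apply/matrixP => i j; rewrite !mxE; apply: eq_bigr => k _; rewrite !mxE.
apply/matrixP => b t; rewrite -mulmxA [LHS]mxE (bigD1 (keep b))//= big1 => [|i ib].
  by rewrite mul_diag_mx !mxE eqxx mul1r addr0.
by rewrite !mxE (negbTE (_ : keep b != i)) ?mul0r// eq_sym.
Qed.

Lemma mxsq_weights (Q : 'M[R]_m) : Q^T = Q -> Q *m Q = Q ->
  mxsq (Q *m M) = \sum_i sigma 0 i ^+ 2 * (U^T *m Q *m U) i i.
Proof.
move=> sQ QQ; have [_ VV _ _ ->] := svd.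
rewrite mxsq_projE//; set P := U^T *m Q *m U.
rewrite [X in \tr X](_ : _ = V *m (diag_mx sigma *m P *m diag_mx sigma) *m V^T).
  rewrite mxtrace_mulC [V^T *m (V *m _)]mulmxA VV mul1mx; apply: eq_bigr => i _.
  by rewrite mul_mx_diag mul_diag_mx; move: P => P; rewrite !mxE; ring.
by rewrite !trmx_mul trmxK tr_diag_mx /P !mulmxA.
Qed.

(** [W] does no better than the projection [Q M] onto its column space. The energy captured by [Q]
    is the sum of the [sigma_i ^ 2] with weights [|Q u_i| ^ 2], which lie in [[0, 1]] and add up to
    at most [\rank W]; the [r] leading vectors capture at least as much. *)
Lemma eckart_young (W : 'M[R]_(m, n)) : (\rank W <= r)%N ->
  mxsq (M - lead_vectors *m (lead_vectors^T *m M)) <= mxsq (M - W).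
Proof.
move=> rW; have [UU VV s0 sd ME] := svd.
have [Q [sQ QQ QW nQ]] := column_projector W.
apply: (@le_trans _ _ (mxsq (M - Q *m M))); last first.
  rewrite (mxsq_proj (M - W) sQ QQ) mulmxBr QW opprB addrA subrK.
  by rewrite lerDr mxsq_ge0.
have := mxsq_pythagoras M 0 lead_vectors_ortho; rewrite mulmx0 !subr0.
have := mxsq_proj M sQ QQ; set a := mxsq M; set b := mxsq (M - _).
set c := mxsq (M - _); suff : mxsq (Q *m M) <= mxsq (lead_vectors^T *m M) by lra.
have nL : mxsq (lead_vectors^T *m M) = \sum_(i < minn m n | (i < r)%N) sigma 0 i ^+ 2.
  rewrite lead_vectors_mul /mxsq.
  transitivity (\sum_(b < minn r (minn m n)) sigma 0 (keep b) ^+ 2).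
    apply: eq_bigr => i _; under eq_bigr do rewrite mxE exprMn.
    rewrite -mulr_sumr -[RHS]mulr1; congr (_ * _).
    have VVii : (V^T *m V) (keep i) (keep i) = 1 by rewrite VV mxE eqxx.
    rewrite -[RHS]VVii mxE.
    by apply: eq_bigr => j _; rewrite mxE expr2.
  rewrite (eq_bigl (fun i : 'I_(minn m n) => i < minn r (minn m n))%N); last first.
    by move=> i; rewrite leq_min ltn_ord andbT.
  by rewrite (big_ord_narrow (geq_minr r (minn m n))).
rewrite nL mxsq_weights//; apply: sum_weight_le => [i|i j ij|i|].
- exact: sqr_ge0.
- by rewrite lerXn2r ?nnegrE ?s0 ?sd.
- have wE : (U^T *m Q *m U) i i = mxsq (Q *m col i U).
    rewrite mxsq_projE// [RHS]big_ord1 colE trmx_mul -bform_delta /bform.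
    by rewrite !mulmxA.
  have u1 : mxsq (col i U) = 1.
    rewrite mxsqE [LHS]big_ord1 colE trmx_mul -mulmxA [U^T *m _]mulmxA UU mul1mx.
    by rewrite trmx_delta mul_delta_mx mxE !eqxx.
  by rewrite wE mxsq_ge0 -u1 (mxsq_proj (col i U) sQ QQ) lerDl mxsq_ge0.
rewrite -/(\tr _) -mxsq_projE//.
apply: le_trans (_ : (\rank W)%:R <= _); last by rewrite ler_nat.
rewrite -nQ mxsqE mxtrace_mulC.
have -> : Q *m U *m (Q *m U)^T = ((U^T *m Q)^T *m (U^T *m Q)).
  by rewrite !trmx_mul trmxK sQ !mulmxA.
by rewrite -mxsqE; apply: mxsq_coisometry_le.
Qed.

End EckartYoung.

(** * Error propagation along the sweep *)

Section Sweep.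
Context {R : realType}.

Definition vsq n rho (B : multi_index n -> 'cV[R]_rho) : R :=
  \sum_i \sum_a B i a 0 ^+ 2.

Definition values_mx n rho (B : multi_index n -> 'cV[R]_rho)
    : 'M[R]_(rho, #|{: multi_index n}|) :=
  \matrix_(a, t) B (enum_val t) a 0.

(* The unfolding of [X] after its first [q] modes, the rank index being a row
   index, has rank at most [r]. *)
Definition separated n rho (q r : nat) (X : multi_index n -> 'cV[R]_rho) : Prop :=
  exists (r' : nat) (F : 'I_rho -> seq 'I_2 -> 'I_r' -> R) (G : 'I_r' -> seq 'I_2 -> R),
    (r' <= r)%N /\
    forall i a, X i a 0 = \sum_c F a (take q i) c * G c (drop q i).

Lemma vsq_values_mx n rho (B : multi_index n -> 'cV[R]_rho) :
  vsq B = mxsq (values_mx B).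
Proof.
rewrite /vsq /mxsq exchange_big; apply: eq_bigr => a _ /=.
rewrite (reindex (@enum_val (multi_index n) xpredT)) /=; last exact/onW_bij/enum_val_bij.
by apply: eq_bigr => t _; rewrite mxE.
Qed.

Lemma vsq_remainder_mx n rho (B : multi_index n.+1 -> 'cV[R]_rho) :
  vsq B = mxsq (remainder_mx B).
Proof.
pose f (p : 'I_2 * multi_index n) := cons_tuple p.1 p.2.
have bf : bijective f.
  exists (fun i => (thead i, behead_tuple i)) => [[i t]|i]; rewrite /f /=.
    by rewrite theadE; congr (_, _); exact: val_inj.
  by rewrite [RHS]tuple_eta.
rewrite /vsq (reindex f) /=; last exact/onW_bij.
rewrite /mxsq (reindex (@enum_rank ('I_rho * 'I_2)%type)) /=; last first.
  exact/onW_bij/enum_rank_bij.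
transitivity (\sum_(p : 'I_rho * 'I_2) \sum_(t : multi_index n)
                B (cons_tuple p.2 t) p.1 0 ^+ 2).
  rewrite -(pair_big xpredT xpredT (fun a i => \sum_t B (cons_tuple i t) a 0 ^+ 2)) /=.
  rewrite -(pair_big xpredT xpredT (fun i t => \sum_a B (cons_tuple i t) a 0 ^+ 2)) /=.
  by rewrite [RHS]exchange_big; apply: eq_bigr => i _; rewrite exchange_big.
apply: eq_bigr => p _.
rewrite (reindex (@enum_val (multi_index n) xpredT)) /=; last exact/onW_bij/enum_val_bij.
by apply: eq_bigr => t _; rewrite mxE enum_rankK.
Qed.

Lemma values_mxB n rho (B X : multi_index n -> 'cV[R]_rho) :
  values_mx (fun i => B i - X i) = values_mx B - values_mx X.
Proof. by apply/matrixP => i j; rewrite !mxE. Qed.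

Lemma remainder_mxB n rho (B X : multi_index n.+1 -> 'cV[R]_rho) :
  remainder_mx (fun i => B i - X i) = remainder_mx B - remainder_mx X.
Proof. by apply/matrixP => i j; rewrite !mxE. Qed.

Lemma rank_remainder_mx n rho r (X : multi_index n.+1 -> 'cV[R]_rho) :
  separated 1 r X -> (\rank (remainder_mx X) <= r)%N.
Proof.
move=> [r' [F [G [rr' XE]]]].
pose FM : 'M[R]_(#|{: 'I_rho * 'I_2}|, r') :=
  \matrix_(a, c) F (enum_val a).1 [:: (enum_val a).2] c.
have -> : remainder_mx X = FM *m \matrix_(c, t) G c (enum_val t : multi_index n).
  apply/matrixP => a t; rewrite !mxE XE /= take0 drop0.
  by apply: eq_bigr => c _; rewrite !mxE.
by apply: leq_trans (mxrankM_maxl _ _) _; apply: leq_trans (rank_leq_col _) rr'.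
Qed.

(** [U] acts on the rank index and the first mode, which both belong to the left factor; the right
    factor and the inner size stay the same. *)
Lemma separated_project n rho k (U : 'M[R]_(#|{: 'I_rho * 'I_2}|, k))
    q r (X : multi_index n.+1 -> 'cV[R]_rho) :
  separated q.+1 r X ->
  separated q r (fun t => U^T *m col (enum_rank t) (remainder_mx X)).
Proof.
move=> [r' [F [G [rr' XE]]]]; exists r'.
exists (fun b s c => \sum_a U a b * F (enum_val a).1 ((enum_val a).2 :: s) c), G.
split=> // t b; rewrite mxE.
under eq_bigr do rewrite !mxE enum_rankK XE /= mulr_sumr.
rewrite exchange_big; apply: eq_bigr => c _; rewrite mulr_suml.
by apply: eq_bigr => a _; rewrite mulrA.
Qed.

Lemma values_mx_cols n k (A : 'M[R]_(k, #|{: multi_index n}|)) :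
  values_mx (fun t => col (enum_rank t) A) = A.
Proof. by apply/matrixP => i j; rewrite !mxE enum_valK. Qed.

(* The first split costs at most [|B - X|^2] by Eckart-Young, and projecting both
   [B] and [X] onto the leading singular vectors keeps the ranks of [X] and does
   not increase their distance, so each split costs at most [|B - X|^2]. *)
Lemma tt_svd_rec_quasi_optimal n rho rs (B Y X : multi_index n.+1 -> 'cV[R]_rho) :
  tt_svd_rec rs B Y ->
  (forall q, (q < n)%N -> separated q.+1 (nth 0%N rs q) X) ->
  vsq (fun i => B i - Y i) <= n%:R * vsq (fun i => B i - X i).
Proof.
elim: n rho rs B Y X => [|n ih] rho rs B Y X /=.
  move=> YB _; rewrite mul0r /vsq big1// => i _; rewrite big1// => a _.
  by rewrite YB subrr mxE expr0n.
move=> [U [sigma [V [Y' [svd rec YE]]]]] Xsep.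
set r := head 0%N rs in rec YE.
pose L := lead_vectors r U.
have LL : L^T *m L = 1%:M := lead_vectors_ortho r svd.
pose X' t := L^T *m col (enum_rank t) (remainder_mx X).
have B'E : values_mx (tt_next r sigma V) = L^T *m remainder_mx B.
  rewrite (lead_vectors_mul r svd); apply/matrixP => b t.
  by rewrite !mxE enum_valK.
have X'E : values_mx X' = L^T *m remainder_mx X.
  rewrite -[RHS]values_mx_cols; apply/matrixP => b t; rewrite !mxE.
  by apply: eq_bigr => a _; rewrite !mxE.
have YE' : remainder_mx Y = L *m values_mx Y'.
  apply/matrixP => a t; rewrite [LHS]mxE YE mxE [RHS]mxE.
  apply: eq_bigr => b _; rewrite !mxE theadE -surjective_pairing enum_valK.
  by congr (_ * Y' _ _ _); exact: val_inj.
have ih' := ih _ _ _ _ X' rec.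
(* Pythagoras separates the truncation error of this split from the error of the rest of the sweep,
   measured in the coordinates of [L]. *)
rewrite vsq_remainder_mx remainder_mxB YE' (mxsq_pythagoras _ _ LL).
rewrite [X in n.+1%:R * X]vsq_remainder_mx remainder_mxB.
rewrite -natr1 mulrDl mul1r addrC; apply: lerD; last first.
  apply: (eckart_young svd); apply: rank_remainder_mx.
  by rewrite /r -nth0; exact: Xsep.
rewrite -B'E -values_mxB -vsq_values_mx.
apply: le_trans (ih' _) _ => [q qn|].
  by rewrite nth_behead; apply: separated_project; exact: Xsep.
rewrite ler_wpM2l// vsq_values_mx values_mxB B'E X'E -mulmxBr.
exact: mxsq_coisometry_le.
Qed.

End Sweep.

Section TensorNorm.
Context {R : realType} {d : nat}.
Implicit Types X Y Z : tensor R d.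

Lemma frob_dotDl X Y Z : frob_dot (X + Y) Z = frob_dot X Z + frob_dot Y Z.
Proof.
by rewrite /frob_dot -big_split; apply: eq_bigr => i _; rewrite !ffunE mulrDl.
Qed.

Lemma frob_dot_ge0 X : 0 <= frob_dot X X.
Proof. by apply: sumr_ge0 => i _; rewrite -expr2 sqr_ge0. Qed.

Lemma frob_norm_ge0 X : 0 <= frob_norm X.
Proof. exact: sqrtr_ge0. Qed.

Lemma sqr_frob_norm X : frob_norm X ^+ 2 = frob_dot X X.
Proof. by rewrite sqr_sqrtr// frob_dot_ge0. Qed.

Lemma frob_normN X : frob_norm (- X) = frob_norm X.
Proof.
by congr Num.sqrt; apply: eq_bigr => i _; rewrite !ffunE mulrNN.
Qed.

Lemma frob_norm_triangle X Y : frob_norm (X + Y) <= frob_norm X + frob_norm Y.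
Proof.
have hX := frob_norm_ge0 X; have hY := frob_norm_ge0 Y.
rewrite -(@ler_pXn2r _ 2) ?nnegrE ?addr_ge0 ?frob_norm_ge0//.
rewrite sqrrD !sqr_frob_norm frob_dotDl ![frob_dot _ (X + Y)]frob_dotC !frob_dotDl.
rewrite (frob_dotC Y X).
suff : frob_dot X Y <= frob_norm X * frob_norm Y by rewrite -mulr_natr; lra.
apply: (le_trans (ler_norm _)).
rewrite -(@ler_pXn2r _ 2) ?nnegrE ?mulr_ge0// exprMn !sqr_frob_norm.
rewrite real_normK ?num_real//.
pose v Z : 'cV[R]_#|{: multi_index d}| := \col_i Z (enum_val i).
have vE A B : frob_dot A B = bform 1 (v A) (v B).
  rewrite bform1E /frob_dot (reindex (@enum_val (multi_index d) xpredT)) /=.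
    by apply: eq_bigr => i _; rewrite !mxE.
  exact/onW_bij/enum_val_bij.
by rewrite !vE; apply: cauchy_schwarz_bform; exact: psd1.
Qed.

(** A rank factorization of the unfolding supplies the two factors. The defaults of [insubd] are
    never reached, since the pieces of [i] have sizes [q] and [d - q]. *)
Lemma separated_unfolding X q r : (q <= d)%N -> (\rank (unfolding X q) <= r)%N ->
  separated q r (fun i => const_mx (X i) : 'cV[R]_1).
Proof.
move=> qd rX; exists (\rank (unfolding X q)).
exists (fun _ s c =>
  col_base (unfolding X q) (enum_rank (insubd (nseq_tuple q 0) s)) c).
exists (fun c s =>
  row_base (unfolding X q) c (enum_rank (insubd (nseq_tuple (d - q) 0) s))).
split=> // i a; rewrite mxE.
transitivity (unfolding X q (enum_rank (insubd (nseq_tuple q 0) (take q i)))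
                   (enum_rank (insubd (nseq_tuple (d - q) 0) (drop q i)))).
  rewrite mxE !enum_rankK; congr (X _); apply: val_inj.
  have -> : tval (insubd (nseq_tuple q 0) (take q i)) = take q i.
    by rewrite [LHS]val_insubd size_takel ?size_tuple ?eqxx.
  have -> : tval (insubd (nseq_tuple (d - q) 0) (drop q i)) = drop q i.
    by rewrite [LHS]val_insubd size_drop size_tuple eqxx.
  by rewrite cat_take_drop val_insubd size_tuple eqxx.
by rewrite -[in LHS](mulmx_base (unfolding X q)) mxE.
Qed.

End TensorNorm.

Lemma TTSVD_quasi_optimal (R : realType) (d : nat) (rr : (d.-1).-tuple nat)
    (Z Xi X : tensor R d) : is_TTSVD rr Z Xi -> tt_rank_le X rr ->
  frob_norm (Xi - Z) <= Num.sqrt (d - 1)%:R * frob_norm (Z - X).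
Proof.
case: d rr Z Xi X => [|n] rr Z Xi X /=.
  move=> -> _; rewrite subrr [leLHS](_ : _ = 0) ?mulr_ge0 ?sqrtr_ge0//.
  by rewrite /frob_norm /frob_dot big1 ?sqrtr0// => i _; rewrite ffunE mul0r.
move=> [Y [rec XiE]] rX; rewrite subn1 /=.
have vE (A B : tensor R n.+1) (f g : multi_index n.+1 -> 'cV[R]_1) :
    (forall i, f i 0 0 = A i) -> (forall i, g i 0 0 = B i) ->
    frob_norm (A - B) ^+ 2 = vsq (fun i => f i - g i).
  move=> fA gB; rewrite sqr_frob_norm; apply: eq_bigr => i _.
  by rewrite big_ord1 !mxE fA gB !ffunE expr2.
rewrite -frob_normN opprB.
rewrite -(@ler_pXn2r _ 2) ?nnegrE ?mulr_ge0 ?sqrtr_ge0//.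
rewrite exprMn (sqr_sqrtr (ler0n R n)).
pose v (A : tensor R n.+1) i : 'cV[R]_1 := const_mx (A i).
have vA (A : tensor R n.+1) i : v A i 0 0 = A i by rewrite mxE.
rewrite (vE Z Xi (v Z) Y)// (vE Z X (v Z) (v X))//.
apply: tt_svd_rec_quasi_optimal rec _ => q qn.
apply: separated_unfolding; first by rewrite ltnS ltnW.
by have := rX (Ordinal qn); rewrite tnth_mktuple (tnth_nth 0%N).
Qed.

(** * Walsh-Hadamard measurements of low-order tensors *)

Lemma tensmx11 (V : pzRingType) m n : (1%:M : 'M[V]_m) *t (1%:M : 'M[V]_n) = 1%:M.
Proof.
apply/matrixP => i j.
case: (mxtens_indexP i) => i0 i1; case: (mxtens_indexP j) => j0 j1.
rewrite tensmxE !mxE -natrM mulnb -xpair_eqE.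
by rewrite (inj_eq (can_inj (@mxtens_indexK _ _))).
Qed.

Section Hadamard.
Context {R : realType}.

Lemma hadamard2_sqr i j : (hadamard2 i j : R) ^+ 2 = 2^-1.
Proof.
rewrite !mxE exprMn exprVn sqr_sqrtr//.
by case: ifP => _; rewrite ?sqrrN expr1n mulr1.
Qed.

Lemma hadamard2_ortho : (hadamard2^T *m hadamard2 : 'M[R]_2) = 1%:M.
Proof.
rewrite /hadamard2 [(_ *: _)^T]linearZ /= -scalemxAr -scalemxAl scalerA.
rewrite -expr2 exprVn sqr_sqrtr//.
apply/matrixP => i j; rewrite !mxE !big_ord_recl big_ord0 !mxE addr0.
by case: i => [[|[|//]]] ? ; case: j => [[|[|//]]] ?; rewrite /=; field.
Qed.

Lemma hadamard_sqr d i j : (hadamard d i j : R) ^+ 2 = (2 ^ d)%:R^-1.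
Proof.
case: d i j => [|d] i j; first by rewrite mxE !ord1 eqxx expr1n invr1.
(* [ntensmx] treats the power zero apart, so the induction starts at the power one. *)
rewrite /hadamard /ntensmx; elim: d i j => [|d ih] i j; first exact: hadamard2_sqr.
by rewrite /= [in LHS]mxE exprMn ih hadamard2_sqr [in RHS]expnS natrM invfM.
Qed.

Lemma hadamard_ortho d : ((hadamard d)^T *m hadamard d : 'M[R]_(2 ^ d)) = 1%:M.
Proof.
case: d => [|d]; first by rewrite /hadamard /ntensmx trmx1 mulmx1.
rewrite /hadamard /ntensmx; elim: d => [|d ih]; first exact: hadamard2_ortho.
by rewrite /= trmx_tens tensmx_mul ih hadamard2_ortho tensmx11.
Qed.

End Hadamard.

Section Positions.
Context {d : nat}.

Lemma sum_bits_lt n (f : nat -> nat) : (forall k, f k < 2)%N ->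
  (\sum_(k < n) f k * 2 ^ k < 2 ^ n)%N.
Proof.
move=> f2; elim: n => [|n ih]; first by rewrite big_ord0.
rewrite big_ord_recr /= expnS mul2n -addnn -addSn leq_add//.
by have := f2 n; case: (f n) => [|[|]]//; rewrite mul1n.
Qed.

Lemma position_proof (i : multi_index d) : (\sum_(q < d) tnth i q * 2 ^ q < 2 ^ d)%N.
Proof.
rewrite (eq_bigr (fun q : 'I_d => nth ord0 i q * 2 ^ q)%N) => [|q _].
  exact: (sum_bits_lt d (f := fun k => nth ord0 i k)).
by rewrite (tnth_nth ord0).
Qed.

Definition position i : 'I_(2 ^ d) := Ordinal (position_proof i).

(** [vecE] at the indicator tensor of [i] inverts the digit map without repeating the arithmetic;
    hence the real type in the statement. *)
Lemma positionK (R : realType) : cancel position (@digits d).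
Proof.
move=> i; pose X : tensor R d := [ffun j => (j == i)%:R].
have : vec X (position i) 0 = X i by exact: vecE.
by rewrite mxE !ffunE eqxx; case: eqP => // _ /esym/eqP; rewrite oner_eq0.
Qed.

Lemma position_bij (R : realType) : bijective position.
Proof.
apply: inj_card_bij; first exact: can_inj (positionK R).
by rewrite card_tuple !card_ord.
Qed.

Lemma canonical_index_inj : injective (@canonical_index d).
Proof.
move=> A B AB; apply/setP => j.
have := congr1 (fun t => tnth t j) AB; rewrite !tnth_mktuple.
by case: (j \in A); case: (j \in B).
Qed.

End Positions.

Section LowOrder.
Context {R : realType} {d : nat}.

Lemma canonical_span_eq0 (p : pred {set 'I_d}) (X : tensor R d) i :
  X \in canonical_span p -> (forall J, p J -> i != canonical_index J) -> X i = 0.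
Proof.
move=> /coord_span -> iN; rewrite sum_ffunE big1// => k _.
rewrite ffunE; set Y := _`_k.
have : Y \in [seq canonical_tensor J | J <- enum p] by apply: mem_nth; rewrite size_tuple.
move=> /mapP[J]; rewrite mem_enum => pJ ->.
by rewrite ffunE (negbTE (iN _ pJ)) scaler0.
Qed.

Lemma LC_low_order k s (X : tensor R d) : LC k s X -> X \in low_order_space s.
Proof.
move=> [S [XS [Ss XSS ->]]]; apply: rpred_sum => t _.
apply: subvP (XSS t); apply: sub_span => Y /mapP[J]; rewrite mem_enum => JS ->.
by apply: map_f; rewrite mem_enum /= inE; apply: leq_trans (subset_leq_card JS) (Ss t).
Qed.

Variable s : nat.

Definition low_sets : {set {set 'I_d}} := [set J : {set 'I_d} | (#|J| <= s)%N].

Lemma card_low_sets : #|low_sets| = (\sum_(l < s.+1) 'C(d, l))%N.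
Proof.
rewrite (eq_bigr (fun l : 'I_s.+1 => \sum_(J : {set 'I_d}) (#|J| == l))%N); last first.
  move=> l _; rewrite -{1}(card_ord d) -card_draws -sum1_card big_mkcond /=.
  by apply: eq_bigr => J _; rewrite inE; case: eqP.
rewrite exchange_big -sum1_card big_mkcond; apply: eq_bigr => J _ /=.
rewrite inE; case: leqP => Js.
  rewrite (bigD1 (Ordinal (Js : #|J| < s.+1)%N))//= eqxx big1 ?addn0// => l.
  by rewrite -val_eqE /= eq_sym => /negbTE ->.
rewrite big1// => l _; apply/eqP; rewrite eqb0; apply/eqP => Jl.
by have := ltn_ord l; rewrite -Jl ltnS leqNgt Js.
Qed.

Lemma low_sets_gt0 : (0 < #|low_sets|)%N.
Proof. by apply/card_gt0P; exists finset.set0; rewrite inE cards0. Qed.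

Definition low_index (a : 'I_#|low_sets|) : multi_index d :=
  canonical_index (enum_val a).

Lemma low_index_inj : injective low_index.
Proof. by move=> a b /canonical_index_inj /enum_val_inj. Qed.

Definition coords (X : tensor R d) : 'cV[R]_#|low_sets| := \col_a X (low_index a).

(** Row [j] of the Walsh-Hadamard matrix restricted to the low-order columns, scaled so that its
    entries are signs. *)
Definition sample_vector (j : 'I_(2 ^ d)) : 'cV[R]_#|low_sets| :=
  \col_a (Num.sqrt (2 ^ d)%:R * hadamard d j (position (low_index a))).

Lemma sum_low_order (X : tensor R d) (F : multi_index d -> R) :
  X \in low_order_space s -> \sum_i F i * X i = \sum_a F (low_index a) * coords X a 0.
Proof.
move=> XV.
rewrite (bigID (fun i => i \in [set low_index a | a in [set: 'I_#|low_sets|]])) /=.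
rewrite [X in _ + X]big1 ?addr0 => [|i iN]; last first.
  rewrite (canonical_span_eq0 XV) ?mulr0// => J Js; apply: contraNneq iN => ->.
  have Js' : J \in low_sets by rewrite inE.
  apply/imsetP; exists (enum_rank_in Js' J); first by rewrite inE.
  by rewrite /low_index (enum_rankK_in Js' Js').
rewrite big_imset /=; last by move=> a b _ _; exact: low_index_inj.
by apply: eq_big => [a|a _]; rewrite ?inE// mxE.
Qed.

Lemma frob_dot_coords (X W : tensor R d) : X \in low_order_space s ->
  frob_dot X W = bform 1 (coords W) (coords X).
Proof.
move=> XV; rewrite frob_dotC bform1E /frob_dot (sum_low_order (fun i => W i : R) XV).
by apply: eq_bigr => a _; rewrite [in RHS]mxE.
Qed.

Lemma sample_vector_norm j : bform 1 (sample_vector j) (sample_vector j) = #|low_sets|%:R.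
Proof.
rewrite bform1E (eq_bigr (fun=> 1)) => [|a _]; first by rewrite sumr_const card_ord.
by rewrite mxE -expr2 exprMn sqr_sqrtr// hadamard_sqr mulfV//.
Qed.

Lemma sample_vector_iso :
  \sum_j sample_vector j *m (sample_vector j)^T = (2 ^ d)%:R%:M.
Proof.
apply/matrixP => a b; rewrite summxE.
transitivity ((2 ^ d)%:R * ((hadamard d)^T *m hadamard d : 'M[R]_(2 ^ d))
                 (position (low_index a)) (position (low_index b))).
  rewrite [X in _ * X]mxE mulr_sumr; apply: eq_bigr => j _.
  by rewrite !mxE big_ord1 !mxE mulrACA -expr2 sqr_sqrtr.
rewrite hadamard_ortho !mxE (inj_eq (can_inj (positionK R))) (inj_eq low_index_inj).
by rewrite mulr_natr.
Qed.

Lemma hadamard_vec (X : tensor R d) j : X \in low_order_space s ->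
  Num.sqrt (2 ^ d)%:R * (hadamard d *m vec X) j 0 = bform 1 (sample_vector j) (coords X).
Proof.
move=> XV; rewrite mxE (reindex position) /=; last exact/onW_bij/(position_bij R).
rewrite (eq_bigr (fun i => hadamard d j (position i) * X i)); last first.
  by move=> i _; rewrite [vec X _ _]mxE (positionK R).
rewrite (sum_low_order _ XV) bform1E mulr_sumr.
by apply: eq_bigr => a _; rewrite [in RHS]mxE mulrA.
Qed.

Section Measurement.
Variables (m : nat) (nu : 'I_m -> 'I_(2 ^ d)).
Hypothesis m_gt0 : (0 < m)%N.

Lemma measurementE (X : tensor R d) l : X \in low_order_space s ->
  measurement nu X l 0 = (Num.sqrt m%:R)^-1 * bform 1 (sample_vector (nu l)) (coords X).
Proof.
move=> XV; rewrite -hadamard_vec// /measurement /measurement_mx -scalemxAl mxE.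
rewrite -mulmxA [X in _ * X]mxE (bigD1 (nu l))//= big1 => [|j jN]; last first.
  by rewrite mxE (negbTE jN) mul0r.
by rewrite mxE eqxx mul1r addr0 sqrtrM// sqrtrV// [_ / _]mulrC -mulrA.
Qed.

Lemma measurement_dot (X W : tensor R d) : X \in low_order_space s ->
  W \in low_order_space s ->
  \sum_l measurement nu X l 0 * measurement nu W l 0 =
  m%:R^-1 * bform (gram sample_vector m [ffun l => nu l]) (coords X) (coords W).
Proof.
move=> XV WV; rewrite /gram [X in bform X](eq_bigl xpredT); last first.
  by move=> l; rewrite ltn_ord.
rewrite bform_summ mulr_sumr; apply: eq_bigr => l _; rewrite ffunE.
rewrite !measurementE// -[_ *m _]mul1r -[1 * _]mulr1 bform_rank1.
rewrite -[X in X * _ = _]/(_ * _) -[X in _ = _ * (X * _)]bform_tr trmx1.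
have m0 : Num.sqrt m%:R != 0 :> R by rewrite gt_eqF// sqrtr_gt0 ltr0n.
by rewrite -{3}(sqr_sqrtr (ler0n R m)); field.
Qed.

End Measurement.
End LowOrder.

(** The upper bound at [x + y / eta] minus the lower bound at [x - y / eta] reads [4 |y|^2 / eta <=
    2 eta |x|^2 + 2 |y|^2 / eta]; the scaling by [1 / eta] balances the two terms. *)
Lemma bform_bound_of_quadratic (R : realFieldType) n (E : 'M[R]_n)
    (x y : 'cV[R]_n) (eta : R) :
  E^T = E -> 0 < eta -> (forall z, `|bform E z z| <= eta * bform 1 z z) ->
  bform 1 y y = bform E x y -> bform 1 y y <= eta ^+ 2 * bform 1 x x.
Proof.
move=> sE eta0 hE yE.
have sym u v : bform E u v = bform E v u by rewrite -{1}sE bform_tr.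
have := hE (x + eta^-1 *: y); have := hE (x + (- eta^-1) *: y).
rewrite !(bformDl, bformDr, bformZl, bformZr) (sym y x) (bform1C y x) -yE.
rewrite !ler_norml => /andP[h1 _] /andP[_ h2].
set a := bform 1 y y in h1 h2 *; set b := bform 1 x x in h1 h2 *.
set e := bform E x x in h1 h2; set g := bform E y y in h1 h2.
set c := bform 1 x y in h1 h2.
suff : 4 * (eta^-1 * a) <= 2 * eta * b + 2 * (eta^-1 * a).
  move=> h; have : eta^-1 * a <= eta * b by lra.
  by rewrite mulrC ler_pdivrMr// mulrAC -expr2.
have E1 : eta * (eta^-1 * (eta^-1 * a)) = eta^-1 * a.
  by field; exact: lt0r_neq0.
have {h1 h2} := lerB h2 h1; lra.
Qed.

(** * Error of the initializer *)

Section Initialization.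
Context {R : realType} {d m s : nat}.
Variable nu : 'I_m -> 'I_(2 ^ d).

Fact measurement_is_linear : linear (measurement nu : tensor R d -> 'cV[R]_m).
Proof.
move=> a X Y; rewrite /measurement scalemxAr -mulmxDr; congr (_ *m _).
by apply/colP => j; rewrite !mxE !ffunE.
Qed.

HB.instance Definition _ := GRing.isLinear.Build R (tensor R d) 'cV[R]_m _
  (measurement nu) measurement_is_linear.

(** The error [Y] lies in the low-order space, so the projection disappears when it is tested
    against [Y]: [|Y|^2 = <A X, A Y> - <X, Y>], which is the form of [E = G / m - 1] at the
    coordinates of [X] and [Y]. *)
Lemma init_error (X : tensor R d) (eta : R) : (0 < m)%N -> 0 < eta ->
  (forall z, `|bform (gram (@sample_vector R d s) m [ffun l => nu l]) z z
               - m%:R * bform 1 z z| <= eta * m%:R * bform 1 z z) ->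
  X \in low_order_space s ->
  frob_norm (orthogonal_projection (low_order_space s)
    (adjoint (measurement nu) (measurement nu X)) - X) <= eta * frob_norm X.
Proof.
move=> m0 eta0 hG XV; set T := adjoint _ _.
have [] := orthogonal_projectionP (low_order_space s) T.
set Z := orthogonal_projection _ T => ZV ZT.
pose Y := Z - X; have YV : Y \in low_order_space s by exact: rpredB.
pose G := gram (@sample_vector R d s) m [ffun l => nu l].
pose E := m%:R^-1 *: G - 1.
have m0' : 0 < m%:R :> R by rewrite ltr0n.
have [sG _] := psd_gram (@sample_vector R d s) m [ffun l => nu l].
have YE : bform 1 (coords s Y) (coords s Y) = bform E (coords s X) (coords s Y).
  have -> : bform 1 (coords s Y) (coords s Y) = frob_dot Y Y.
    by rewrite (frob_dot_coords _ YV).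
  rewrite {1}/Y frob_dotBl (frob_dot_coords _ XV) bformBm bformZm -measurement_dot//.
  have := ZT Y YV; rewrite frob_dotBl => /eqP; rewrite subr_eq0 => /eqP <-.
  rewrite frob_dotC adjointP; congr (_ - _).
    by apply: eq_bigr => l _; rewrite mulrC.
  exact: bform1C.
rewrite -(@ler_pXn2r _ 2) ?nnegrE ?mulr_ge0 ?frob_norm_ge0 ?(ltW eta0)//.
rewrite exprMn !sqr_frob_norm (frob_dot_coords _ YV) (frob_dot_coords _ XV).
apply: bform_bound_of_quadratic YE => //.
  by rewrite /E linearB linearZ /= sG trmx1.
move=> z; rewrite bformBm bformZm.
have -> : m%:R^-1 * bform G z z - bform 1 z z =
    m%:R^-1 * (bform G z z - m%:R * bform 1 z z).
  by field; exact: lt0r_neq0.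
by rewrite normrM ger0_norm ?invr_ge0// mulrC ler_pdivrMr// mulrAC; exact: hG.
Qed.

Lemma TTSVD_init_error (X Xinit : tensor R d) (eta : R) (rr : (d.-1).-tuple nat) :
  (0 < m)%N -> 0 < eta ->
  (forall z, `|bform (gram (@sample_vector R d s) m [ffun l => nu l]) z z
               - m%:R * bform 1 z z| <= eta * m%:R * bform 1 z z) ->
  X \in low_order_space s -> tt_rank_le X rr ->
  is_TTSVD rr (orthogonal_projection (low_order_space s)
    (adjoint (measurement nu) (measurement nu X))) Xinit ->
  frob_norm (Xinit - X) <= (1 + Num.sqrt (d - 1)%:R) * eta * frob_norm X.
Proof.
move=> m0 eta0 hG XV rX; set Z := orthogonal_projection _ _ => init.
have -> : Xinit - X = (Xinit - Z) + (Z - X) by rewrite addrA subrK.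
apply: le_trans (frob_norm_triangle _ _) _.
apply: le_trans (lerD (TTSVD_quasi_optimal init rX) (lexx _)) _.
rewrite -mulrA -[X in _ + X]mul1r -mulrDl addrC ler_wpM2l ?addr_ge0 ?sqrtr_ge0//.
exact: init_error.
Qed.

End Initialization.

(** * From counting sample maps to probabilities *)

Section IidProbability.
Local Open Scope classical_set_scope.
Context {R : realType} {disp : measure_display} {T : measurableType disp}.
Variables (P : probability T R) (m N : nat) (nu : 'I_m -> T -> 'I_N).
Hypothesis iid : iid_uniform P nu.

Lemma iid_uniform_point (f : {ffun 'I_m -> 'I_N}) :
  P [set w | [ffun l => nu l w] = f] = ((N%:R^-1) ^+ m)%:E.
Proof.
have [_ unif indep] := iid.
have := indep [set: 'I_m]%SET (fun l => [set f l]).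
under eq_bigr do rewrite unif.
rewrite prodEFin prodr_const cardsT card_ord => <-; congr (P _).
apply/seteqP; split=> [w <- l _|w fw] /=; first by rewrite ffunE.
by apply/ffunP => l; rewrite ffunE; apply: fw => /=; rewrite inE.
Qed.

Lemma iid_uniform_le (bad : pred {ffun 'I_m -> 'I_N}) :
  (P [set w | bad [ffun l => nu l w]] <= (#|bad|%:R * (N%:R^-1) ^+ m)%:E)%E.
Proof.
have -> : [set w | bad [ffun l => nu l w]] =
    \big[setU/set0]_(f <- enum bad) [set w | [ffun l => nu l w] = f].
  rewrite -bigcup_seq; apply/seteqP; split=> [w bw|w [f /=]] /=.
    by exists [ffun l => nu l w] => //=; rewrite mem_enum.
  by rewrite mem_enum => bf ->.
rewrite cardE; elim: (enum bad) => [|f r ih] /=.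
  by rewrite big_nil measure0 mul0r.
have mf g : measurable [set w | [ffun l => nu l w] = g].
  exact: (iid_uniform_measurable (fun h => [ffun l => h l] = g) iid).
rewrite big_cons -natr1 addrC mulrDl mul1r EFinD -(iid_uniform_point f).
apply: le_trans (measureU2 _ _ _) _ => //; last by rewrite leeD2l.
exact: bigsetU_measurable.
Qed.

End IidProbability.

Section Concentration.
Local Open Scope classical_set_scope.
Context {R : realType} {disp : measure_display} {T : measurableType disp}.
Variables (P : probability T R) (n N m : nat) (nu : 'I_m -> T -> 'I_N).
Variable x : 'I_N -> 'cV[R]_n.
Hypothesis iid : iid_uniform P nu.
Hypotheses (n_gt0 : (0 < n)%N) (N_gt0 : (0 < N)%N).
Hypothesis x_norm : forall j, bform 1 (x j) (x j) = n%:R.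
Hypothesis x_iso : \sum_j x j *m (x j)^T = N%:R%:M.

(** Each tail receives [delta / 2]; together with the dimension factor [n] this produces the
    logarithm of [2 n / delta]. *)
Lemma gram_concentration (eta delta : R) (Q : ('I_m -> 'I_N) -> Prop) :
  0 < eta < 1 -> 0 < delta ->
  ln (2 * n%:R / delta) <= 3 / 8 * eta ^+ 2 * m%:R / n%:R ->
  (forall f : {ffun 'I_m -> 'I_N},
    (forall z, `|bform (gram x m f) z z - m%:R * bform 1 z z|
               <= eta * m%:R * bform 1 z z) -> Q f) ->
  ((1 - delta)%:E <= P [set w | Q (fun l => nu l w)])%E.
Proof.
move=> eta01 delta0 hm hQ.
have n0 : 0 < n%:R :> R by rewrite ltr0n.
have N0 : 0 < N%:R :> R by rewrite ltr0n.
pose up : pred {ffun 'I_m -> 'I_N} := fun f => `[< exists2 z : 'cV[R]_n,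
  z != 0 & (1 + eta) * m%:R * bform 1 z z <= bform (gram x m f) z z >].
pose lo : pred {ffun 'I_m -> 'I_N} := fun f => `[< exists2 z : 'cV[R]_n,
  z != 0 & bform (gram x m f) z z <= (1 - eta) * m%:R * bform 1 z z >].
have exp_le : expR (- (3 / 8 * eta ^+ 2 * m%:R / n%:R)) <= delta / (2 * n%:R).
  rewrite -[leRHS]invrK expRN lef_pV2 ?posrE ?expR_gt0 ?invr_gt0 ?divr_gt0 ?mulr_gt0//.
  by rewrite invf_div -ler_ln ?posrE ?expR_gt0 ?divr_gt0 ?mulr_gt0// expRK.
have tail (bad : pred {ffun 'I_m -> 'I_N}) :
    #|bad|%:R <= N%:R ^+ m * n%:R * expR (- (3 / 8 * eta ^+ 2 * m%:R / n%:R)) ->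
    (P [set w | bad [ffun l => nu l w]] <= (delta / 2)%:E)%E.
  move=> hbad; apply: le_trans (iid_uniform_le iid bad) _.
  rewrite lee_fin exprVn ler_pdivrMr ?exprn_gt0//; apply: le_trans hbad _.
  rewrite -mulrA mulrC ler_pM2r ?exprn_gt0// mulrC -ler_pdivlMr//.
  by apply: le_trans exp_le _; rewrite invfM mulrA.
have Pup : (P [set w | up [ffun l => nu l w]] <= (delta / 2)%:E)%E.
  by apply/tail/(upper_tail n_gt0 N_gt0 x_norm x_iso eta01) => f /asboolP.
have Plo : (P [set w | lo [ffun l => nu l w]] <= (delta / 2)%:E)%E.
  by apply/tail/(lower_tail n_gt0 N_gt0 x_norm x_iso eta01) => f /asboolP.
have mE (bad : pred {ffun 'I_m -> 'I_N}) :
    measurable [set w | bad [ffun l => nu l w]].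
  exact: (iid_uniform_measurable (fun h => bad [ffun l => h l]) iid).
have mQ : measurable [set w | Q (fun l => nu l w)].
  exact: iid_uniform_measurable iid.
have subs : ~` [set w | Q (fun l => nu l w)] `<=`
    [set w | up [ffun l => nu l w]] `|` [set w | lo [ffun l => nu l w]].
  move=> w /= nQ; apply: contrapT => /not_orP[/negP/asboolPn nup /negP/asboolPn nlo].
  apply: nQ; have -> : (fun l => nu l w) = [ffun l => nu l w].
    by apply/funext => l; rewrite ffunE.
  apply: hQ => z; have [->|zN0] := eqVneq z 0.
    by rewrite -[0](scale0r 0) !bformZl !mul0r !mulr0 subrr normr0.
  rewrite ler_norml; apply/andP; split.
    rewrite leNgt; apply/negP => h; apply: nlo; exists z => //.
    rewrite mulrBl mulrBl mul1r; lra.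
  rewrite leNgt; apply/negP => h; apply: nup; exists z => //.
  rewrite mulrDl mulrDl mul1r; lra.
have PC : (P (~` [set w | Q (fun l => nu l w)]) <= delta%:E)%E.
  apply: (@le_trans _ _ (P ([set w | up [ffun l => nu l w]] `|`
    [set w | lo [ffun l => nu l w]]))).
    by apply: le_measure => //; rewrite inE; [exact: measurableC|exact: measurableU].
  apply: le_trans (measureU2 _ _ _) _ => //.
  apply: le_trans (leeD Pup Plo) _.
  by rewrite -EFinD -splitr.
rewrite -[X in P X]setCK probability_setC; last exact: measurableC.
by rewrite EFinB leeB.
Qed.

End Concentration.

Local Open Scope classical_set_scope.
Local Open Scope ring_scope.

Theorem theorem5p4 (R : realType) (d r k s m : nat) (C eps delta : R)
    (disp : measure_display) (T : measurableType disp) (P : probability T R)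
    (nu : 'I_m -> T -> 'I_(2 ^ d)) :
  let alpha : R := 1 + Num.sqrt (d - 1)%:R in
  let D : R := (\sum_(l < s.+1) 'C(d, l))%:R in
  (1 <= d)%N -> (1 <= r)%N -> (1 <= k)%N -> (s <= d)%N ->
  0 < C -> 0 < eps < 1 -> 0 < delta < 1 ->
  iid_uniform P nu ->
  8 * D * alpha ^+ 2 / (3 * eps ^+ 2) * ln (2 * D / delta) <= m%:R ->
  ((1 - delta)%:E <=
   P [set w | forall X : tensor R d, low_order_model r s k C X ->
        forall rr : (d.-1).-tuple nat,
          (forall q, (1 <= tnth rr q)%N) -> tt_rank_le X rr ->
        forall Xinit : tensor R d,
          is_TTSVD rr
            (orthogonal_projection (low_order_space s)
               (adjoint (measurement (fun l => nu l w))
                  (measurement (fun l => nu l w) X)))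
            Xinit ->
        (frob_norm (Xinit - X) <= eps * frob_norm X)%R])%E.
Proof.
move=> alpha D _ _ _ _ _ /andP[eps0 eps1] /andP[delta0 delta1] iid.
have -> : D = #|low_sets s : {set {set 'I_d}}|%:R by rewrite card_low_sets.
have n_gt0 := @low_sets_gt0 d s; set n := #|_| in n_gt0 *.
have n0 : 0 < n%:R :> R by rewrite ltr0n.
have n1 : 1 <= n%:R :> R by rewrite ler1n.
have alpha1 : 1 <= alpha by rewrite lerDl sqrtr_ge0.
have alpha0 : 0 < alpha by exact: lt_le_trans alpha1.
(* Positivity of the logarithm, from [n >= 1] and [delta < 1], is what forces [m > 0]. *)
have ln0 : 0 < ln (2 * n%:R / delta).
  by rewrite ln_gt0// ltr_pdivlMr// mul1r; lra.
have c0 : 0 < 8 * n%:R * alpha ^+ 2 / (3 * eps ^+ 2).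
  by rewrite divr_gt0 ?mulr_gt0 ?exprn_gt0.
move=> hm; have m0 : (0 < m)%N.
  by rewrite -(ltr0n R); apply: lt_le_trans hm; exact: mulr_gt0.
have eta0 : 0 < eps / alpha by rewrite divr_gt0.
pose Q (g : 'I_m -> 'I_(2 ^ d)) := forall X : tensor R d,
  low_order_model r s k C X -> forall rr : (d.-1).-tuple nat,
  (forall q, (1 <= tnth rr q)%N) -> tt_rank_le X rr -> forall Xinit : tensor R d,
  is_TTSVD rr (orthogonal_projection (low_order_space s)
    (adjoint (measurement g) (measurement g X))) Xinit ->
  frob_norm (Xinit - X) <= eps * frob_norm X.
apply: (gram_concentration (Q := Q) (eta := eps / alpha) iid n_gt0 _
  (@sample_vector_norm R d s) (@sample_vector_iso R d s)) => //.
- by rewrite expn_gt0.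
- by rewrite eta0 ltr_pdivrMr// mul1r (lt_le_trans eps1).
(* The prefactor is the inverse of the rate [3 / 8 * eta ^+ 2 / n] at [eta = eps / alpha], so the
   assumed sample size is exactly the required one. *)
- rewrite -(ler_pM2l c0); apply: le_trans hm _.
  rewrite le_eqVlt; apply/orP; left; apply/eqP.
  by field; rewrite !lt0r_neq0.
move=> f hf X [_ XLC _] rr _ rX Xinit.
have fE : [ffun l => f l] = f by apply/ffunP => l; rewrite ffunE.
rewrite -fE in hf.
move=> /(TTSVD_init_error m0 eta0 hf (LC_low_order XLC) rX).
by rewrite -/alpha mulrC [alpha * _]mulrC divfK ?lt0r_neq0// mulrC.
Qed.
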